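(* Let $\lambda$ be a nonzero dominant integral weight of $\mathfrak g$. $\mathbf U_q^\lambda(\mathfrak g)$ is isomorphic to the unital associative $\mathbb Q(q)$-algebra $\dot{\mathbf U}_q^\lambda(\mathfrak g)$ generated by $\{\xi_i^\pm,x_i^\pm\}_{i\in\mathbf I}\cup\{\xi_\lambda^\pm\}$, subject to the relations (for all $i,j\in\mathbf I$) $$\xi_i^\pm\xi_i^\mp=1=\xi_\lambda^\pm\xi_\lambda^\mp,\qquad [\xi_i^\pm,\xi_j^\pm]=0=[\xi_i^\pm,\xi_\lambda^\pm],$$ $$\xi_i^+x_j^\pm\xi_i^-=q^{\pm(\alpha_i,\alpha_j)}x_j^\pm,\qquad \xi_\lambda^+x_j^\pm\xi_\lambda^-=q^{\pm(\lambda,\alpha_j)}x_j^\pm,$$ $$[x_i^+,x_j^-]=\delta_{ij}\frac{\xi_i^+-\xi_i^-}{q_i-q_i^{-1}},$$ $$\sum_{b=0}^{1-a_{ij}}(-1)^b\begin{bmatrix}1-a_{ij}\\ b\end{bmatrix}_{q_i}(x_i^\pm)^bx_j^\pm(x_i^\pm)^{1-a_{ij}-b}=0\quad (i\ne j).$$ Explicitly, the assignment $$x_i^+\mapsto E_i,\quad x_i^-\mapsto F_i,\quad\xi_i^\pm\mapsto K_i^{\pm1},\quad\xi_\lambda^\pm\mapsto K_\lambda^{\pm1}v^{\mp1}$$ uniquely extends to an isomorphism of $\mathbb Q(q)$-algebras $\varphi:\dot{\mathbf U}_q^\lambda(\mathfrak g)\xrightarrow{\sim}\mathbf U_q^\lambda(\mathfrak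 g)$.
   Context: $\mathfrak g$ is a complex simple Lie algebra with Cartan subalgebra $\mathfrak h$, simple roots $\{\alpha_i\}_{i\in\mathbf I}$ and invariant non-degenerate symmetric bilinear form $(\cdot,\cdot)$ normalized so that short simple roots have square length $2$; $d_i=(\alpha_i,\alpha_i)/2$, $a_{ij}=(\alpha_i,\alpha_j)/d_i$ (Cartan matrix), $q_i=q^{d_i}$. $\mathsf Q=\bigoplus_i\mathbb Z\alpha_i\subset\mathsf\Lambda$ are the root and weight lattices. $\begin{bmatrix}n\\ r\end{bmatrix}_q=\frac{[n]_q!}{[r]_q![n-r]_q!}$ with $[m]_q=\frac{q^m-q^{-m}}{q-q^{-1}}$. For a $\mathbb Z$-module $\mathsf Q\subset\mathcal E\subset\mathsf\Lambda$, $U_q^{\mathcal E}(\mathfrak g)$ is the unital associative $\mathbb Q(q)$-algebra generated by $E_i,F_i$ ($i\in\mathbf I$), $K_\mu^{\pm1}$ ($\mu\in\mathcal E$) with relations $K_\mu K_\gamma=K_{\mu+\gamma}$, $K_0=1$, $K_\mu E_jK_\mu^{-1}=q^{(\mu,\alpha_j)}E_j$, $K_\mu F_jK_\mu^{-1}=q^{-(\mu,\alpha_j)}F_j$, $[E_i,F_j]=\delta_{ij}\frac{K_{\alpha_i}-K_{-\alpha_i}}{q_i-q_i^{-1}}$, and for $i\neq j$ the $q$-Serre relations $\sum_{b=0}^{1-a_{ij}}(-1)^b\begin{bmatrix}1-a_{ij}\\ b\end{bmatrix}_{q_i}Z_i^bZ_jZ_i^{1-a_{ij}-b}=0$ for $Z=E$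 and $Z=F$. $K_i:=K_{\alpha_i}$; $U_q(\mathfrak g):=U_q^{\mathsf Q}(\mathfrak g)$, a Hopf algebra. $V$ is the finite-dimensional irreducible type $1$ $U_q(\mathfrak g)$-module of highest weight $\lambda$, $V_\mu=\{w\in V:K_\beta w=q^{(\mu,\beta)}w\ \forall\beta\in\mathsf Q\}$, $\mathsf\Lambda_\lambda=\{\mu\in\mathsf\Lambda:V_\mu\ne0\}$, $\mathsf\Lambda(\lambda)=\mathbb Z\mathsf\Lambda_\lambda$ (which contains $\mathsf Q$), and $U_q^\lambda(\mathfrak g):=U_q^{\mathsf\Lambda(\lambda)}(\mathfrak g)$. $\mathbf U_q^\lambda(\mathfrak g)$ is the subalgebra of $U_q^\lambda(\mathfrak g)\otimes\mathbb Q(q)[v^{\pm1}]$ generated by $\{E_i,F_i\}_{i\in\mathbf I}$ and $\{K_\mu^{\pm1}v^{\mp1}\}_{\mu\in\mathsf\Lambda_\lambda}$. *)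

(* Defs.v *)
From HB Require Import structures.
From mathcomp Require Import all_boot all_order all_algebra.
From mathcomp Require Import generic_quotient complex.
From mathcomp Require Import boolp classical_sets reals.

Set Implicit Arguments.
Unset Strict Implicit.
Unset Printing Implicit Defensive.
Import GRing.Theory.
Local Open Scope ring_scope.
Local Open Scope quotient_scope.

(** [term k X] is the type of noncommutative polynomial expressions in the
  indeterminates [X]; the algebra with relations [r] is the quotient of
  [term k X] by the least congruence [cong r] that contains [r] and the axioms
  of unital associative [k]-algebras, where [TCst] is the structure map from
  [k].  Since an [algType] is nonzero by definition, a [presentation] carries
  a proof that 1 <> 0 follows. *)

Inductive term (k X : Type) : Type :=
| TGen of X
| TCst of k
| TAdd of term k X & term k X
| TMul of term k X & term k X.
Arguments TGen {k X} _.
Arguments TCst {k X} _.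

HB.instance Definition _ (k X : Type) := gen_eqMixin (term k X).
HB.instance Definition _ (k X : Type) := gen_choiceMixin (term k X).

Declare Scope term_scope.
Delimit Scope term_scope with T.
Bind Scope term_scope with term.
Notation "0" := (TCst 0%R) : term_scope.
Notation "1" := (TCst 1%R) : term_scope.
Notation "s + t" := (TAdd s t) : term_scope.
Notation "s * t" := (TMul s t) : term_scope.
Notation "c *: t" := (TMul (TCst c%R) t) : term_scope.
Notation "s - t" := (TAdd s (TMul (TCst (-1)%R) t)) : term_scope.
Notation "t ^+ n" := (iter n (TMul t) (TCst 1%R)) : term_scope.

Inductive cong (k : fieldType) (X : Type) (r : term k X -> term k X -> Prop) :
    term k X -> term k X -> Prop :=
| cong_rel s t : r s t -> cong r s t
| cong_refl t : cong r t t
| cong_sym s t : cong r s t -> cong r t s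
| cong_trans s t u : cong r s t -> cong r t u -> cong r s u
| cong_add s s' t t' : cong r s s' -> cong r t t' -> cong r (s + t) (s' + t')
| cong_mul s s' t t' : cong r s s' -> cong r t t' -> cong r (s * t) (s' * t')
| cong_addA s t u : cong r (s + (t + u)) ((s + t) + u)
| cong_addC s t : cong r (s + t) (t + s)
| cong_add0 t : cong r (0 + t) t
| cong_addN t : cong r ((-1) *: t + t) 0
| cong_mulA s t u : cong r (s * (t * u)) ((s * t) * u)
| cong_mul1 t : cong r (1 * t) t
| cong_mulDl s t u : cong r ((s + t) * u) (s * u + t * u)
| cong_mulDr s t u : cong r (s * (t + u)) (s * t + s * u)
| cong_cstD c d : cong r (TCst (c + d)%R) (TCst c + TCst d)
| cong_cstM c d : cong r (TCst (c * d)%R) (TCst c * TCst d)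
| cong_cstC c t : cong r (TCst c * t) (t * TCst c).

Record presentation (k : fieldType) := Presentation {
  pgen : Type;
  prel : term k pgen -> term k pgen -> Prop;
  pres_nz : ~ cong prel 1 0 }.

Section PresentedAlgebra.
Variables (k : fieldType) (P : presentation k).
Local Notation cg := (cong (@prel k P)).

Definition pequiv : rel (term k (pgen P)) := fun s t => `[< cg s t >].

Lemma pequiv_refl : reflexive pequiv.
Proof. by move=> t; apply/asboolP; apply: cong_refl. Qed.
Lemma pequiv_sym : symmetric pequiv.
Proof.
by move=> s t; apply/idP/idP => /asboolP H; apply/asboolP; apply: cong_sym.
Qed.
Lemma pequiv_trans : transitive pequiv.
Proof.
move=> t s u /asboolP H1 /asboolP H2; apply/asboolP; exact: cong_trans H1 H2.
Qed.
Canonical pequiv_equiv := EquivRel pequiv pequiv_refl pequiv_sym pequiv_trans.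

Definition palg : Type := {eq_quot pequiv}.
HB.instance Definition _ : EqQuotient _ pequiv palg := EqQuotient.on palg.
HB.instance Definition _ := Choice.on palg.

Definition pcls (t : term k (pgen P)) : palg := \pi_palg t.

Lemma pclsP s t : pcls s = pcls t <-> cg s t.
Proof.
split=> [/eqP|H]; first by rewrite /pcls eqmodE => /asboolP.
by apply/eqP; rewrite /pcls eqmodE; apply/asboolP.
Qed.

Lemma pcls_surj x : exists t, x = pcls t.
Proof. by exists (repr x); rewrite /pcls reprK. Qed.

Definition padd (x y : palg) : palg := pcls (TAdd (repr x) (repr y)).
Definition pmul (x y : palg) : palg := pcls (TMul (repr x) (repr y)).
Definition popp (x : palg) : palg := pcls (TMul (TCst (-1)) (repr x)).
Definition pscale (c : k) (x : palg) : palg := pcls (TMul (TCst c) (repr x)).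

Lemma cong_repr t : cg (repr (pcls t)) t.
Proof. by apply/pclsP; rewrite /pcls reprK. Qed.

Lemma paddE s t : padd (pcls s) (pcls t) = pcls (s + t)%T.
Proof. by apply/pclsP; apply: cong_add; apply: cong_repr. Qed.
Lemma pmulE s t : pmul (pcls s) (pcls t) = pcls (s * t)%T.
Proof. by apply/pclsP; apply: cong_mul; apply: cong_repr. Qed.
Lemma poppE t : popp (pcls t) = pcls ((-1) *: t)%T.
Proof. by apply/pclsP; apply: cong_mul; [exact: cong_refl|exact: cong_repr]. Qed.
Lemma pscaleE c t : pscale c (pcls t) = pcls (c *: t)%T.
Proof. by apply/pclsP; apply: cong_mul; [exact: cong_refl|exact: cong_repr]. Qed.

Let E := (paddE, pmulE, poppE, pscaleE).

Fact paddA : associative padd.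
Proof.
move=> x y z; have [[s ->] [t ->] [u ->]] := And3 (pcls_surj x) (pcls_surj y) (pcls_surj z).
by rewrite !E; apply/pclsP; apply: cong_addA.
Qed.
Fact paddC : commutative padd.
Proof.
move=> x y; have [[s ->] [t ->]] := conj (pcls_surj x) (pcls_surj y).
by rewrite !E; apply/pclsP; apply: cong_addC.
Qed.
Fact padd0 : left_id (pcls 0%T) padd.
Proof.
by move=> x; have [s ->] := pcls_surj x; rewrite !E; apply/pclsP; apply: cong_add0.
Qed.
Fact paddN : left_inverse (pcls 0%T) popp padd.
Proof.
by move=> x; have [s ->] := pcls_surj x; rewrite !E; apply/pclsP; apply: cong_addN.
Qed.
Fact pmulA : associative pmul.
Proof.
move=> x y z; have [[s ->] [t ->] [u ->]] := And3 (pcls_surj x) (pcls_surj y) (pcls_surj z).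
by rewrite !E; apply/pclsP; apply: cong_mulA.
Qed.
Fact pmul1l : left_id (pcls 1%T) pmul.
Proof.
by move=> x; have [s ->] := pcls_surj x; rewrite !E; apply/pclsP; apply: cong_mul1.
Qed.
Fact pmul1r : right_id (pcls 1%T) pmul.
Proof.
move=> x; have [s ->] := pcls_surj x; rewrite !E; apply/pclsP.
exact: cong_trans (cong_sym (cong_cstC _ _ _)) (cong_mul1 _ _).
Qed.
Fact pmulDl : left_distributive pmul padd.
Proof.
move=> x y z; have [[s ->] [t ->] [u ->]] := And3 (pcls_surj x) (pcls_surj y) (pcls_surj z).
by rewrite !E; apply/pclsP; apply: cong_mulDl.
Qed.
Fact pmulDr : right_distributive pmul padd.
Proof.
move=> x y z; have [[s ->] [t ->] [u ->]] := And3 (pcls_surj x) (pcls_surj y) (pcls_surj z).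
by rewrite !E; apply/pclsP; apply: cong_mulDr.
Qed.
Fact pone_neq0 : pcls 1%T != pcls 0%T.
Proof. by apply/eqP => /pclsP; apply: pres_nz. Qed.

HB.instance Definition _ := GRing.isZmodule.Build palg paddA paddC padd0 paddN.
HB.instance Definition _ := GRing.Zmodule_isNzRing.Build palg
  pmulA pmul1l pmul1r pmulDl pmulDr pone_neq0.

Fact pscaleA a b x : pscale a (pscale b x) = pscale (a * b) x.
Proof.
have [s ->] := pcls_surj x; rewrite !E; apply/pclsP.
apply: cong_trans (cong_mulA _ _ _ _) _.
apply: cong_mul (cong_refl _ _); exact: cong_sym (cong_cstM _ _ _).
Qed.
Fact pscale1 : left_id 1 pscale.
Proof.
by move=> x; have [s ->] := pcls_surj x; rewrite !E; apply/pclsP; apply: cong_mul1.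
Qed.
Fact pscaleDr : right_distributive pscale +%R.
Proof.
move=> a x y; have [[s ->] [t ->]] := conj (pcls_surj x) (pcls_surj y).
by rewrite /GRing.add /= !E; apply/pclsP; apply: cong_mulDr.
Qed.
Fact pscaleDl x : {morph pscale^~ x : a b / a + b}.
Proof.
move=> a b; have [s ->] := pcls_surj x; rewrite [in RHS]/GRing.add /= !E.
apply/pclsP; apply: cong_trans _ (cong_mulDl _ _ _ _).
exact: cong_mul (cong_cstD _ _ _) (cong_refl _ _).
Qed.
HB.instance Definition _ := GRing.Zmodule_isLmodule.Build k palg
  pscaleA pscale1 pscaleDr pscaleDl.

Fact pscaleAl a (x y : palg) : a *: (x * y) = (a *: x) * y.
Proof.
have [[s ->] [t ->]] := conj (pcls_surj x) (pcls_surj y).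
rewrite /GRing.scale /= /GRing.mul /= !E; apply/pclsP; exact: cong_mulA.
Qed.
Fact pscaleAr a (x y : palg) : a *: (x * y) = x * (a *: y).
Proof.
have [[s ->] [t ->]] := conj (pcls_surj x) (pcls_surj y).
rewrite /GRing.scale /= /GRing.mul /= !E; apply/pclsP.
apply: cong_trans (cong_mulA _ _ _ _) _.
apply: cong_trans _ (cong_sym (cong_mulA _ _ _ _)).
exact: cong_mul (cong_cstC _ _ _) (cong_refl _ _).
Qed.
HB.instance Definition _ := GRing.Lmodule_isLalgebra.Build k palg pscaleAl.
HB.instance Definition _ := GRing.Lalgebra_isAlgebra.Build k palg pscaleAr.

Definition gen (x : pgen P) : palg := pcls (TGen x).

End PresentedAlgebra.
Arguments gen {k P} x.

Fixpoint interp (k : fieldType) (X : Type) (A : algType k) (f : X -> A)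
    (t : term k X) : A :=
  match t with
  | TGen x => f x
  | TCst c => c%:A
  | TAdd s u => interp f s + interp f u
  | TMul s u => interp f s * interp f u
  end.

Lemma interp_cong (k : fieldType) (X : Type) (r : term k X -> term k X -> Prop)
    (A : algType k) (f : X -> A) :
  (forall s t, r s t -> interp f s = interp f t) ->
  forall s t, cong r s t -> interp f s = interp f t.
Proof.
move=> rf s t; elim=> {s t} //=.
- by move=> s t u _ -> _ ->.
- by move=> s s' t t' _ -> _ ->.
- by move=> s s' t t' _ -> _ ->.
- by move=> *; rewrite addrA.
- by move=> *; rewrite addrC.
- by move=> *; rewrite scale0r add0r.
- by move=> *; rewrite scaleN1r mulN1r addNr scale0r.
- by move=> *; rewrite mulrA.
- by move=> *; rewrite scale1r mul1r.
- by move=> *; rewrite mulrDl.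
- by move=> *; rewrite mulrDr.
- by move=> *; rewrite scalerDl.
- by move=> *; rewrite -scalerAl mul1r scalerA.
- by move=> *; rewrite -scalerAl mul1r -scalerAr mulr1.
Qed.

Lemma interp_nz (k : fieldType) (X : Type) (r : term k X -> term k X -> Prop)
    (A : algType k) (f : X -> A) :
  (forall s t, r s t -> interp f s = interp f t) -> ~ cong r 1 0.
Proof.
move=> rf /(interp_cong rf) /= /eqP; rewrite scale1r scale0r.
by rewrite (negPf (oner_neq0 A)).
Qed.

(* The universal property of [palg P]. *)
Lemma palg_lift (k : fieldType) (P : presentation k) (A : algType k)
    (f : pgen P -> A) :
  (forall s t, prel s t -> interp f s = interp f t) ->
  exists phi : {lrmorphism palg P -> A},
    (forall x, phi (gen x) = f x) /\
    forall psi : {lrmorphism palg P -> A},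
      (forall x, psi (gen x) = f x) -> psi =1 phi.
Proof.
move=> rf; pose F (x : palg P) : A := interp f (repr x).
have FE t : F (pcls t) = interp f t.
  by apply: (interp_cong rf); apply: cong_repr.
have Fadd : zmod_morphism F.
  move=> x y; have [[s ->] [t ->]] := conj (pcls_surj x) (pcls_surj y).
  rewrite /GRing.opp /GRing.add /= poppE paddE !FE /=.
  by rewrite scaleN1r mulN1r.
have Fmul : monoid_morphism F.
  split; first by rewrite /GRing.one /= FE /= scale1r.
  move=> x y; have [[s ->] [t ->]] := conj (pcls_surj x) (pcls_surj y).
  by rewrite {1}/GRing.mul /= pmulE !FE.
have Fscal : scalable F.
  move=> a x; have [s ->] := pcls_surj x.
  by rewrite {1}/GRing.scale /= pscaleE !FE /= -scalerAl mul1r.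
pose F1 := GRing.isZmodMorphism.Build _ _ F Fadd.
pose F2 := GRing.isMonoidMorphism.Build _ _ F Fmul.
pose F3 := GRing.isScalable.Build _ _ _ _ F Fscal.
pose phi : {lrmorphism palg P -> A} := HB.pack F F1 F2 F3.
exists phi; split=> [x|psi psif x]; first by rewrite /= FE.
have [s ->] := pcls_surj x; rewrite /= FE; elim: s => /= [y|c|s1 I1 s2 I2|s1 I1 s2 I2].
- exact: psif.
- have -> : pcls (TCst c) = c%:A :> palg P.
    rewrite /GRing.scale /= /GRing.one /= pscaleE; apply/pclsP.
    apply: cong_sym; apply: cong_trans (cong_cstC _ _ _) _; exact: cong_mul1.
  by rewrite linearZ /= rmorph1.
- by rewrite -paddE -I1 -I2 -rmorphD.
- by rewrite -pmulE -I1 -I2 -rmorphM.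
Qed.

Section GeneratedSubalgebra.
Variables (k : fieldType) (A : algType k) (S : set A).

Inductive in_subalg : A -> Prop :=
| in_subalg_gen x : S x -> in_subalg x
| in_subalg_cst c : in_subalg c%:A
| in_subalg_add x y : in_subalg x -> in_subalg y -> in_subalg (x + y)
| in_subalg_mul x y : in_subalg x -> in_subalg y -> in_subalg (x * y).

Definition subalg_pred : {pred A} := fun x => `[< in_subalg x >].

Fact subalg_pred_closed : subalg_closed subalg_pred.
Proof.
split.
- by apply/asboolP; rewrite -(scale1r 1); apply: in_subalg_cst.
- move=> a x y /asboolP Hx /asboolP Hy; apply/asboolP.
  apply: in_subalg_add => //; rewrite -[x]mul1r scalerAl.
  by apply: in_subalg_mul => //; apply: in_subalg_cst.
- move=> x y /asboolP Hx /asboolP Hy; apply/asboolP; exact: in_subalg_mul.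
Qed.
HB.instance Definition _ :=
  GRing.isSubalgClosed.Build k A subalg_pred subalg_pred_closed.

Record subalg : Type := Subalg {
  subalg_val : A;
  subalg_valP : subalg_val \in subalg_pred }.
HB.instance Definition _ := [isSub for subalg_val].
HB.instance Definition _ := [Choice of subalg by <:].
HB.instance Definition _ := [SubChoice_isSubAlgebra of subalg by <:].

End GeneratedSubalgebra.

Section Laurent.
Variable k : fieldType.

(* [TGen true] is v and [TGen false] is v^-1. *)
Inductive laurent_rel : term k bool -> term k bool -> Prop :=
| laurent_inv b : laurent_rel (TGen b * TGen (~~ b)) 1.

Fact laurent_interp s t : laurent_rel s t ->
  interp (fun=> 1 : k^o) s = interp (fun=> 1 : k^o) t.
Proof. by case=> b /=; rewrite mulr1 scale1r. Qed.

Definition laurent_pres := Presentation (interp_nz laurent_interp).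
Definition laurent : algType k := palg laurent_pres.
Definition vp : laurent := @gen k laurent_pres true.
Definition vm : laurent := @gen k laurent_pres false.

End Laurent.

Section Tensor.
Variable k : fieldType.

(* The tensor product of algebras A and B is generated by A and B, each with
   its own algebra structure, subject to A and B commuting elementwise. *)
Inductive tensor_rel (A B : algType k) : term k (A + B) -> term k (A + B) -> Prop :=
| tensor_ladd a a' :
    tensor_rel (TGen (inl (a + a'))) (TGen (inl a) + TGen (inl a'))
| tensor_lmul a a' :
    tensor_rel (TGen (inl (a * a'))) (TGen (inl a) * TGen (inl a'))
| tensor_lcst c : tensor_rel (TGen (inl c%:A)) (TCst c)
| tensor_radd b b' :
    tensor_rel (TGen (inr (b + b'))) (TGen (inr b) + TGen (inr b'))
| tensor_rmul b b' :
    tensor_rel (TGen (inr (b * b'))) (TGen (inr b) * TGen (inr b'))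
| tensor_rcst c : tensor_rel (TGen (inr c%:A)) (TCst c)
| tensor_comm a b : tensor_rel (TGen (inl a) * TGen (inr b))
                               (TGen (inr b) * TGen (inl a)).

Variable A : algType k.

Fact tensor_laurent_nz : ~ cong (@tensor_rel A (laurent k)) 1 0.
Proof.
have [eps _] := @palg_lift k (laurent_pres k) k^o (fun=> 1) (@laurent_interp k).
apply: (@interp_nz _ _ _ A
  (fun x => match x with inl a => a | inr b => (eps b : k)%:A end)).
move=> s t; case=> {s t} //=.
- by move=> b b'; rewrite rmorphD /= scalerDl.
- by move=> b b'; rewrite rmorphM /= -scalerAl mul1r scalerA.
- by move=> c; rewrite linearZ /= rmorph1 /GRing.scale /= mulr1.
- by move=> a b; rewrite -scalerAl -scalerAr mulr1 mul1r.
Qed.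

Definition tensor_laurent_pres := Presentation tensor_laurent_nz.
Definition tensor_laurent : algType k := palg tensor_laurent_pres.
Definition tens (a : A) (b : laurent k) : tensor_laurent :=
  @gen k tensor_laurent_pres (inl a) * @gen k tensor_laurent_pres (inr b).

End Tensor.
Notation "a ⊗ b" := (tens a b) (at level 40, left associativity) : ring_scope.

Record lieAlg (C : fieldType) := LieAlg {
  lie_car :> vectType C;
  lie : lie_car -> lie_car -> lie_car;
  lie_linl : forall c x y z, lie (c *: x + y) z = c *: lie x z + lie y z;
  lie_linr : forall c x y z, lie z (c *: x + y) = c *: lie z x + lie z y;
  lie_alt : forall x, lie x x = 0;
  lie_jacobi : forall x y z,
    lie x (lie y z) + lie y (lie z x) + lie z (lie x y) = 0 }.

Section LieTheory.
Variables (C : fieldType) (g : lieAlg C).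

Definition lie_ideal (W : {vspace g}) : Prop :=
  forall x y : g, y \in W -> lie x y \in W.

Definition lie_simple : Prop :=
  (exists x y : g, lie x y <> 0) /\
  forall W : {vspace g}, lie_ideal W -> W = 0%VS \/ W = fullv.

Definition lie_abelian (W : {vspace g}) : Prop :=
  forall x y : g, x \in W -> y \in W -> lie x y = 0.

Definition ad_diagonalizable (x : g) : Prop :=
  exists b : seq g, basis_of fullv b /\
    forall y, y \in b -> exists c : C, lie x y = c *: y.

(* A Cartan subalgebra of a complex semisimple Lie algebra: a maximal abelian
   subalgebra all of whose elements are ad-semisimple. *)
Definition cartan_subalgebra (h : {vspace g}) : Prop :=
  [/\ lie_abelian h,
      forall W : {vspace g}, lie_abelian W -> (h <= W)%VS -> W = h
    & forall x, x \in h -> ad_diagonalizable x].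

Variable h : {vspace g}.

Definition dual : vectType C := 'Hom(subvs_of h, C^o).

Definition is_root (mu : dual) : Prop :=
  mu <> 0 /\ exists2 x : g, x <> 0 &
    forall y : subvs_of h, lie (vsval y) x = (mu y : C) *: x.

Definition is_simple_system (I : finType) (alpha : I -> dual) : Prop :=
  [/\ forall c : I -> C, \sum_i c i *: alpha i = 0 -> forall i, c i = 0,
      forall i, is_root (alpha i)
    & forall mu, is_root mu -> exists c : I -> nat,
        mu = \sum_i alpha i *+ c i \/ mu = - \sum_i alpha i *+ c i].

Definition invariant_form (B : g -> g -> C) : Prop :=
  [/\ forall c x y z, B (c *: x + y) z = c * B x z + B y z,
      forall x y, B x y = B y x,
      forall x y z, B (lie x y) z = B x (lie y z)
    & forall x, (forall y, B x y = 0) -> x = 0].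

(* [dual_form B] is the form on the dual of h induced by B: [dual_vec B mu] is
   the element of h that represents [mu], so the form is B(t_mu, t_nu). *)
Definition dual_vec (B : g -> g -> C) (mu : dual) : subvs_of h :=
  xget 0 [set t : subvs_of h |
          forall y : subvs_of h, B (vsval t) (vsval y) = mu y].

Definition dual_form (B : g -> g -> C) (mu nu : dual) : C :=
  B (vsval (dual_vec B mu)) (vsval (dual_vec B nu)).

End LieTheory.

(* A simple Lie algebra with the data fixed throughout: Cartan subalgebra,
   simple roots alpha_i and normalized invariant form, with
   d_i = (alpha_i, alpha_i) / 2 and a_ij = (alpha_i, alpha_j) / d_i.  These are
   integers, and are recorded as such because they serve as exponents of q and
   as summation bounds.  The square lengths of the simple roots being 2 d_i,
   that of the short ones is 2 iff the least d_i is 1. *)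
Record simple_setup (C : fieldType) := SimpleSetup {
  sgl :> lieAlg C;
  sgl_simple : lie_simple sgl;
  csa : {vspace sgl};
  csaP : cartan_subalgebra csa;
  Idx : finType;
  alpha : Idx -> dual csa;
  alphaP : is_simple_system alpha;
  bform : sgl -> sgl -> C;
  bformP : invariant_form bform;
  dsym : Idx -> nat;
  dsymP : forall i, dual_form bform (alpha i) (alpha i) = (2 * dsym i)%:R;
  dsym_gt0 : forall i, (0 < dsym i)%N;
  dsym_short : exists i, dsym i = 1%N;
  acart : Idx -> Idx -> int;
  acartP : forall i j,
    dual_form bform (alpha i) (alpha j) = (dsym i)%:R * (acart i j)%:~R }.

Section Weights.
Variables (C : fieldType) (G : simple_setup C).

Definition weight : vectType C := dual (csa G).

Definition pair (mu nu : weight) : C := dual_form (@bform _ G) mu nu.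

(* (mu, nu) as an integer, when it is one (and 0 otherwise). *)
Definition ipair (mu nu : weight) : int :=
  xget 0 [set z : int | z%:~R = pair mu nu].

Definition zspan (S : set weight) : set weight :=
  [set mu | exists (n : nat) (c : 'I_n -> int) (s : 'I_n -> weight),
     (forall l, S (s l)) /\ mu = \sum_l s l *~ c l].

Lemma zspan_sub (S : set weight) (mu : weight) : S mu -> zspan S mu.
Proof.
by move=> Smu; exists 1%N, (fun=> 1), (fun=> mu); rewrite big_ord1.
Qed.

Definition root_lattice : set weight := zspan (range (@alpha _ G)).

Definition coroot_pair (mu : weight) (i : Idx G) : C :=
  2 * pair mu (alpha i) / pair (alpha i) (alpha i).

Definition weight_lattice : set weight :=
  [set mu | forall i, exists z : int, coroot_pair mu i = z%:~R].

Definition dominant_integral (mu : weight) : Prop :=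
  forall i, exists n : nat, coroot_pair mu i = n%:R.

End Weights.

Definition Qq : fieldType := {fraction {poly rat}}.
Definition q : Qq := tofrac 'X.

Definition qint (p : Qq) (m : nat) : Qq := (p ^+ m - p ^- m) / (p - p^-1).
Definition qfact (p : Qq) (m : nat) : Qq := \prod_(1 <= l < m.+1) qint p l.
Definition qbinom (p : Qq) (n r : nat) : Qq :=
  qfact p n / (qfact p r * qfact p (n - r)).

Section Quantum.
Variables (C : fieldType) (G : simple_setup C).
Local Notation I := (Idx G).
Local Notation wt := (weight G).

Definition qi (i : I) : Qq := q ^+ dsym i.

(* The left-hand side of the q-Serre relation for the family Z; for i <> j the
   entry a_ij is nonpositive, so the absolute value is 1 - a_ij itself. *)
Definition serre (X : Type) (Z : I -> X) (i j : I) : term Qq X :=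
  let m := `|1 - acart i j|%N in
  \big[(fun s t => s + t)%T/0%T]_(b < m.+1)
    (((-1) ^+ b * qbinom (qi i) m b) *:
       (TGen (Z i) ^+ b * TGen (Z j) * TGen (Z i) ^+ (m - b)))%T.

Lemma interp_serre0 (X : Type) (A : algType Qq) (f : X -> A) (Z : I -> X) i j :
  f (Z j) = 0 -> interp f (serre Z i j) = 0.
Proof.
move=> fZ; rewrite /serre; set m := `|_|%N; elim/big_rec: _ => /= [|b t _ ->].
  by rewrite scale0r.
by rewrite fZ mulr0 mul0r mulr0 addr0.
Qed.

(* Meant for a subgroup E of the weight lattice that contains the root lattice;
   K_mu^-1 is K_(-mu). *)
Section Uq.
Variable E : set wt.

Inductive Uq_gen : Type :=
| GE of I
| GF of I
| GK mu of E mu.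

Inductive Uq_rel : term Qq Uq_gen -> term Qq Uq_gen -> Prop :=
| Uq_KK mu ga (Em : E mu) (Eg : E ga) (Emg : E (mu + ga)) :
    Uq_rel (TGen (GK Em) * TGen (GK Eg)) (TGen (GK Emg))
| Uq_K0 (E0 : E 0) : Uq_rel (TGen (GK E0)) 1
| Uq_KE mu (Em : E mu) (Em' : E (- mu)) j :
    Uq_rel (TGen (GK Em) * TGen (GE j) * TGen (GK Em'))
           ((q ^ ipair mu (alpha j)) *: TGen (GE j))
| Uq_KF mu (Em : E mu) (Em' : E (- mu)) j :
    Uq_rel (TGen (GK Em) * TGen (GF j) * TGen (GK Em'))
           ((q ^ (- ipair mu (alpha j))) *: TGen (GF j))
| Uq_EF i j (Ea : E (alpha i)) (Ea' : E (- alpha i)) :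
    Uq_rel (TGen (GE i) * TGen (GF j) - TGen (GF j) * TGen (GE i))
           (((i == j)%:R / (qi i - (qi i)^-1)) *:
              (TGen (GK Ea) - TGen (GK Ea')))
| Uq_serreE i j : i <> j -> Uq_rel (serre GE i j) 0
| Uq_serreF i j : i <> j -> Uq_rel (serre GF i j) 0.

Fact Uq_nz : ~ cong Uq_rel 1 0.
Proof.
apply: (@interp_nz _ _ _ Qq^o (fun x => if x is GK _ _ then 1 else 0)).
move=> s t; case=> {s t} /=.
- by move=> *; rewrite mulr1.
- by move=> *; rewrite scale1r.
- by move=> *; rewrite !mulr0 mul0r.
- by move=> *; rewrite !mulr0 mul0r.
- by move=> *; rewrite scaleN1r mulr1 subrr !mulr0 addr0.
- by move=> *; rewrite interp_serre0 // scale0r.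
- by move=> *; rewrite interp_serre0 // scale0r.
Qed.

Definition Uq_pres := Presentation Uq_nz.
Definition Uq : algType Qq := palg Uq_pres.

Definition uE (i : I) : Uq := @gen _ Uq_pres (GE i).
Definition uF (i : I) : Uq := @gen _ Uq_pres (GF i).
(* K_mu for mu in E, and the junk value 0 for other mu. *)
Definition uK (mu : wt) : Uq :=
  if pselect (E mu) is left Em then @gen _ Uq_pres (GK Em) else 0.

End Uq.

Section Modules.
Local Notation U := (Uq (@root_lattice _ G)).
Variables (V : vectType Qq) (act : U -> V -> V).

Definition is_module : Prop :=
  [/\ forall c x y w, act (c *: x + y) w = c *: act x w + act y w,
      forall c x w w', act x (c *: w + w') = c *: act x w + act x w',
      forall w, act 1 w = w
    & forall x y w, act (x * y) w = act x (act y w)].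

Definition is_irreducible : Prop :=
  (exists w : V, w <> 0) /\
  forall W : {vspace V}, (forall x w, w \in W -> act x w \in W) ->
    W = 0%VS \/ W = fullv.

Definition weight_space (mu : wt) : set V :=
  [set w | forall be, root_lattice be ->
     act (uK (@root_lattice _ G) be) w = q ^ ipair mu be *: w].

Definition weights : set wt :=
  [set mu | weight_lattice mu /\ exists2 w, w <> 0 & weight_space mu w].

Definition is_type1 : Prop :=
  forall w : V, exists (n : nat) (mu : 'I_n -> wt) (u : 'I_n -> V),
    (forall l, weight_lattice (mu l) /\ weight_space (mu l) (u l)) /\
    w = \sum_l u l.

Definition has_highest_weight (la : wt) : Prop :=
  exists w : V, [/\ w <> 0, weight_space la w
    & forall i, act (uE (@root_lattice _ G) i) w = 0].

Definition is_irreducible_hw (la : wt) : Prop :=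
  [/\ is_module, is_irreducible, is_type1 & has_highest_weight la].

Definition weights_span : set wt := zspan weights.

Lemma highest_weight_in_span (la : wt) :
  dominant_integral la -> has_highest_weight la -> weights_span la.
Proof.
move=> dla [w [w0 wla _]]; apply: zspan_sub; split; last by exists w.
by move=> i; have [n ->] := dla i; exists n%:Z.
Qed.

(* The tensor product of U_q^lambda(g) and Q(q)[v, v^-1], as an algebra. *)
Definition Uv : algType Qq := tensor_laurent (Uq weights_span).

Definition bU_gens : set Uv :=
  range (fun i => uE weights_span i ⊗ 1) `|`
  range (fun i => uF weights_span i ⊗ 1) `|`
  [set uK weights_span mu ⊗ vm Qq | mu in weights] `|`
  [set uK weights_span (- mu) ⊗ vp Qq | mu in weights].

Definition bU : algType Qq := subalg bU_gens.

End Modules.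

(* Signs are booleans: [true] is + and [false] is -.  The commutation relations
   for opposite signs follow from those listed. *)
Section Udot.
Variable la : wt.

Inductive Udot_gen : Type :=
| Gxi of bool & I
| Gx of bool & I
| Gxil of bool.

Definition sgn (b : bool) : int := if b then 1 else -1.

Inductive Udot_rel : term Qq Udot_gen -> term Qq Udot_gen -> Prop :=
| Udot_xi_inv b i : Udot_rel (TGen (Gxi b i) * TGen (Gxi (~~ b) i)) 1
| Udot_xil_inv b : Udot_rel (TGen (Gxil b) * TGen (Gxil (~~ b))) 1
| Udot_xi_xi b i j :
    Udot_rel (TGen (Gxi b i) * TGen (Gxi b j) - TGen (Gxi b j) * TGen (Gxi b i)) 0
| Udot_xi_xil b i :
    Udot_rel (TGen (Gxi b i) * TGen (Gxil b) - TGen (Gxil b) * TGen (Gxi b i)) 0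
| Udot_xi_x b i j :
    Udot_rel (TGen (Gxi true i) * TGen (Gx b j) * TGen (Gxi false i))
             ((q ^ (sgn b * ipair (alpha i) (alpha j))) *: TGen (Gx b j))
| Udot_xil_x b j :
    Udot_rel (TGen (Gxil true) * TGen (Gx b j) * TGen (Gxil false))
             ((q ^ (sgn b * ipair la (alpha j))) *: TGen (Gx b j))
| Udot_x_x i j :
    Udot_rel (TGen (Gx true i) * TGen (Gx false j)
                - TGen (Gx false j) * TGen (Gx true i))
             (((i == j)%:R / (qi i - (qi i)^-1)) *:
                (TGen (Gxi true i) - TGen (Gxi false i)))
| Udot_serre b i j : i <> j -> Udot_rel (serre (Gx b) i j) 0.

Fact Udot_nz : ~ cong Udot_rel 1 0.
Proof.
apply: (@interp_nz _ _ _ Qq^o (fun x => if x is Gx _ _ then 0 else 1)).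
move=> s t; case=> {s t} /=.
- by move=> *; rewrite mulr1 scale1r.
- by move=> *; rewrite mulr1 scale1r.
- by move=> *; rewrite scaleN1r !mulr1 subrr scale0r.
- by move=> *; rewrite scaleN1r !mulr1 subrr scale0r.
- by move=> *; rewrite !mulr0 mul0r.
- by move=> *; rewrite !mulr0 mul0r.
- by move=> *; rewrite scaleN1r mulr1 subrr !mulr0 addr0.
- by move=> *; rewrite interp_serre0 // scale0r.
Qed.

Definition Udot_pres := Presentation Udot_nz.
Definition Udot : algType Qq := palg Udot_pres.

Definition uxi (b : bool) (i : I) : Udot := @gen _ Udot_pres (Gxi b i).
Definition ux (b : bool) (i : I) : Udot := @gen _ Udot_pres (Gx b i).
Definition uxil (b : bool) : Udot := @gen _ Udot_pres (Gxil b).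

End Udot.

Definition extends_assignment (la : wt) (V : vectType Qq)
    (act : Uq (@root_lattice _ G) -> V -> V)
    (phi : {lrmorphism Udot la -> bU act}) : Prop :=
  let L := weights_span act in
  [/\ forall i, val (phi (ux la true i)) = uE L i ⊗ 1,
      forall i, val (phi (ux la false i)) = uF L i ⊗ 1,
      forall i, val (phi (uxi la true i)) = uK L (alpha i) ⊗ 1 /\
                val (phi (uxi la false i)) = uK L (- alpha i) ⊗ 1
    & val (phi (uxil la true)) = uK L la ⊗ vm Qq /\
      val (phi (uxil la false)) = uK L (- la) ⊗ vp Qq].

End Quantum.

(* Main.v *)
(* Injectivity needs no PBW theorem.  Let [Uv] act on the functions
  g : Z^I -> Udot with g(t + p(alpha_i)) = xi_i g(t), where p(mu) = ((mu,alpha_j))_j,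
  by K_mu g = g(. + p(mu)), E_i g = q^(t_i) x_i^+ g, F_i g = q^(- t_i) x_i^- g
  and v g = xi_lambda^- g(. + p(lambda)).  An element y of Udot then acts so
  that (y g)(0) = y g(0), and there is such a g with g(0) = 1, since the p(alpha_i)
  are linearly independent over Z.

  The map lands in [bU] because every alpha_i is a difference of two weights of V:
  the indices i orthogonal to all weights of V are orthogonal to the other
  indices, hence by connectedness of the Dynkin diagram they would be all of I,
  and lambda would vanish.  It is onto because the weights of V lie in
  lambda + Q, V being irreducible.

  Connectedness of the Dynkin diagram comes from simplicity: when I splits into
  two orthogonal parts every root is supported on one of them, and the roots
  supported on one part generate a proper ideal. *)

From HB Require Import structures.
Require Import Defs.
From mathcomp Require Import all_boot all_order all_algebra.
From mathcomp Require Import complex.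
From mathcomp Require Import boolp classical_sets functions reals.
From mathcomp Require Import ring zify.

Set Implicit Arguments.
Unset Strict Implicit.
Unset Printing Implicit Defensive.
Import Order.TTheory GRing.Theory Num.Theory passmx.
Local Open Scope ring_scope.

(** * Presented algebras *)

(** The setup makes the form positive only on the simple roots, and [C] need not be ordered as a
    real field, so positivity has to come through integers. It comes from the trace form: on a basis
    of weight vectors it is a sum of squares of integers, and it is tied to [bform] by one
    nonnegative factor for each simple root. This yields, for every nonzero nonnegative combination
    of simple roots, a simple root that pairs positively with it; the induction on the height of
    roots rests on that.

    The action cannot live on [Udot] itself: [Uv] contains [K_mu] and [v] separately, while [Udot]
    only knows the products [K_lambda v^-1] and the [K_i]. Hence functions, on which [K_mu] outside
    the root lattice is a free translation, and [v] is chosen so that [K_lambda v^-1] becomes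
    pointwise left multiplication by [xi_lambda]. The factors [q^(t_i)] produce the commutation of
    translations with [E_i] and [F_i], and they equal 1 at the point 0, where values are read
    off. *)

Section Endomorphisms.
Variables (k : fieldType) (V : lmodType k).

Definition is_endo : {pred V -> V} := fun f => `[< linear f >].

Fact is_endo_submod : submod_closed is_endo.
Proof.
split=> [|c f g /asboolP lf /asboolP lg]; apply/asboolP => a x y.
  have E z : (0 : V -> V) z = 0 by [].
  by rewrite !E scaler0 addr0.
have E z : (c *: f + g) z = c *: f z + g z by [].
by rewrite !E lf lg !scalerDr !scalerA [c * a]mulrC addrACA.
Qed.
HB.instance Definition _ :=
  GRing.isSubmodClosed.Build k (V -> V) is_endo is_endo_submod.

(** An [algType] must be nonzero; the proof that [V] has a nonzero vector is therefore a parameter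
    of the type. *)
Record endo (v0 : V) (v0_nz : v0 <> 0) : Type :=
  Endo { endo_val :> V -> V; endoP : endo_val \in is_endo }.

Variables (v0 : V) (v0_nz : v0 <> 0).
Local Notation E := (endo v0_nz).
HB.instance Definition _ := [isSub of E for @endo_val v0 v0_nz].
HB.instance Definition _ := [Choice of E by <:].
HB.instance Definition _ := [SubChoice_isSubLmodule of E by <:].

Lemma endo_eq (f g : E) : (forall x, f x = g x) -> f = g.
Proof. by move=> fg; apply: val_inj; apply/funext. Qed.

Lemma endo_linear (f : E) : linear f.
Proof. by have /asboolP := endoP f. Qed.

Lemma endo_linearZ (f : E) a x : f (a *: x) = a *: f x.
Proof.
have f0 : f 0 = 0.
  have := endo_linear f 1 0 0; rewrite !scale1r addr0 => /(congr1 (+%R^~ (- f 0))).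
  by rewrite addrK subrr.
by rewrite -[a *: x]addr0 endo_linear f0 addr0.
Qed.

Fact endo_one_subproof : id \in is_endo.
Proof. by apply/asboolP. Qed.

Fact endo_mul_subproof (f g : E) : (f \o g : V -> V) \in is_endo.
Proof. by apply/asboolP => a x y /=; rewrite !endo_linear. Qed.

Definition endo_one : E := Endo v0_nz endo_one_subproof.
Definition endo_mul (f g : E) : E := Endo v0_nz (endo_mul_subproof f g).

Fact endo_mulA : associative endo_mul.
Proof. by move=> f g h; apply: endo_eq. Qed.
Fact endo_mul1l : left_id endo_one endo_mul.
Proof. by move=> f; apply: endo_eq. Qed.
Fact endo_mul1r : right_id endo_one endo_mul.
Proof. by move=> f; apply: endo_eq. Qed.
Fact endo_mulDl : left_distributive endo_mul +%R.
Proof. by move=> f g h; apply: endo_eq. Qed.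
Fact endo_mulDr : right_distributive endo_mul +%R.
Proof.
move=> f g h; apply: endo_eq => x.
by have := endo_linear f 1 (g x) (h x); rewrite !scale1r.
Qed.
Fact endo_one_neq0 : endo_one != 0.
Proof.
by apply/eqP => /(congr1 (fun f : E => f v0)).
Qed.
HB.instance Definition _ := GRing.Zmodule_isNzRing.Build E
  endo_mulA endo_mul1l endo_mul1r endo_mulDl endo_mulDr endo_one_neq0.

Fact endo_scaleAl a (f g : E) : a *: (f * g) = (a *: f) * g.
Proof. by apply: endo_eq. Qed.
Fact endo_scaleAr a (f g : E) : a *: (f * g) = f * (a *: g).
Proof.
apply: endo_eq => x.
by rewrite -[LHS]/(a *: f (g x)) -[RHS]/(f (a *: g x)) endo_linearZ.
Qed.
HB.instance Definition _ := GRing.Lmodule_isLalgebra.Build k E endo_scaleAl.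
HB.instance Definition _ := GRing.Lalgebra_isAlgebra.Build k E endo_scaleAr.

End Endomorphisms.

Lemma interp_morph (k : fieldType) (X : Type) (A B : algType k)
    (h : {lrmorphism A -> B}) (f : X -> A) (t : term k X) :
  h (interp f t) = interp (h \o f) t.
Proof.
elim: t => //= [c|s IHs t IHt|s IHs t IHt].
- by rewrite linearZ /= rmorph1.
- by rewrite rmorphD /= IHs IHt.
- by rewrite rmorphM /= IHs IHt.
Qed.

Lemma pcls_interp (k : fieldType) (P : presentation k) (t : term k (pgen P)) :
  pcls t = interp (@gen k P) t.
Proof.
elim: t => //= [c|s IHs t IHt|s IHs t IHt].
- rewrite /GRing.scale /= /GRing.one /= pscaleE; apply/pclsP.
  by apply: cong_sym; apply: cong_trans (cong_cstC _ _ _) _; apply: cong_mul1.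
- by rewrite -paddE -IHs -IHt.
- by rewrite -pmulE -IHs -IHt.
Qed.

Lemma palg_rel (k : fieldType) (P : presentation k) (s t : term k (pgen P)) :
  prel s t -> interp (@gen k P) s = interp (@gen k P) t.
Proof. by move=> st; rewrite -!pcls_interp; apply/pclsP/cong_rel. Qed.

Lemma palg_ind (k : fieldType) (P : presentation k) (p : palg P -> Prop) :
  (forall x, p (gen x)) -> (forall c, p c%:A) ->
  (forall x y, p x -> p y -> p (x + y)) ->
  (forall x y, p x -> p y -> p (x * y)) -> forall x, p x.
Proof.
move=> pg pc pD pM x; have [t ->] := pcls_surj x; rewrite pcls_interp.
by elim: t => /= *; [apply: pg|apply: pc|apply: pD|apply: pM].
Qed.

Lemma comm_palg (k : fieldType) (P : presentation k) (A : algType k)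
    (h : {lrmorphism palg P -> A}) (y : A) :
  (forall x, GRing.comm y (h (gen x))) -> forall x, GRing.comm y (h x).
Proof.
move=> yg; elim/palg_ind => // [c|x1 x2 c1 c2|x1 x2 c1 c2].
- by rewrite linearZ /= rmorph1 /GRing.comm -scalerAl -scalerAr mulr1 mul1r.
- by rewrite rmorphD; apply: commrD.
- by rewrite rmorphM; apply: commrM.
Qed.

Section TensorLaurent.
Variables (k : fieldType) (A : algType k).

Definition tinl (a : A) : tensor_laurent A :=
  @gen k (tensor_laurent_pres A) (inl a).
Definition tinr (b : laurent k) : tensor_laurent A :=
  @gen k (tensor_laurent_pres A) (inr b).

Let trel := @palg_rel k (tensor_laurent_pres A).

Fact tinl_linear : linear tinl.
Proof.
move=> c a a'; rewrite /tinl /tinr; have /= -> := trel (tensor_ladd _ (c *: a) a').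
congr (_ + _); rewrite -[in LHS](mulr_algl c a).
rewrite /tinl /tinr; have /= -> := trel (tensor_lmul _ c%:A a);
  have /= -> := trel (tensor_lcst _ _ c).
by rewrite mulr_algl.
Qed.
HB.instance Definition _ := GRing.isLinear.Build k A _ _ tinl tinl_linear.

Fact tinl_monoid : monoid_morphism tinl.
Proof.
split=> [|a a']; last by rewrite /tinl /tinr; have /= -> := trel (tensor_lmul _ a a').
by have := trel (tensor_lcst A _ 1); rewrite /= !scale1r.
Qed.
HB.instance Definition _ := GRing.isMonoidMorphism.Build A _ tinl tinl_monoid.

Fact tinr_linear : linear tinr.
Proof.
move=> c a a'; rewrite /tinl /tinr; have /= -> := trel (tensor_radd _ (c *: a) a').
congr (_ + _); rewrite -[in LHS](mulr_algl c a).
rewrite /tinl /tinr; have /= -> := trel (tensor_rmul _ c%:A a);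
  have /= -> := trel (tensor_rcst _ _ c).
by rewrite mulr_algl.
Qed.
HB.instance Definition _ := GRing.isLinear.Build k (laurent k) _ _ tinr tinr_linear.

Fact tinr_monoid : monoid_morphism tinr.
Proof.
split=> [|a a']; last by rewrite /tinl /tinr; have /= -> := trel (tensor_rmul _ a a').
by have := trel (tensor_rcst A _ 1); rewrite /= !scale1r.
Qed.
HB.instance Definition _ :=
  GRing.isMonoidMorphism.Build (laurent k) _ tinr tinr_monoid.

Lemma tensE (a : A) b : a ⊗ b = tinl a * tinr b.
Proof. by []. Qed.

Lemma tinlrC a b : tinl a * tinr b = tinr b * tinl a.
Proof. by rewrite /tinl /tinr; have /= -> := trel (tensor_comm a b). Qed.

Lemma tensM (a : A) b (a' : A) b' : (a ⊗ b) * (a' ⊗ b') = (a * a') ⊗ (b * b').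
Proof.
by rewrite !tensE !rmorphM /= mulrA -[_ * _ * tinl a']mulrA -tinlrC !mulrA.
Qed.

Lemma tens1r (a : A) : a ⊗ 1 = tinl a.
Proof. by rewrite tensE rmorph1 mulr1. Qed.

Lemma vmp : vm k * vp k = 1.
Proof.
by have /= := @palg_rel k (laurent_pres k) _ _ (laurent_inv k false); rewrite scale1r.
Qed.

Lemma vpm : vp k * vm k = 1.
Proof.
by have /= := @palg_rel k (laurent_pres k) _ _ (laurent_inv k true); rewrite scale1r.
Qed.

Lemma tensor_lift (B : algType k) (rho : {lrmorphism A -> B})
    (sigma : {lrmorphism laurent k -> B}) :
  (forall a b, rho a * sigma b = sigma b * rho a) ->
  exists phi : {lrmorphism tensor_laurent A -> B},
    forall a b, phi (a ⊗ b) = rho a * sigma b.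
Proof.
move=> comm.
have [|phi [phiE _]] := @palg_lift k (tensor_laurent_pres A) B
  (fun x => match x with inl a => rho a | inr b => sigma b end).
  move=> s t; case=> {s t} //= *; rewrite ?rmorphD ?rmorphM ?linearZ //=;
  by rewrite ?rmorph1.
by exists phi => a b; rewrite /tens rmorphM /= !phiE.
Qed.
End TensorLaurent.

Lemma interp_iter (k : fieldType) (X : Type) (A : algType k) (f : X -> A)
    (t : term k X) n : interp f (iter n (TMul t) (TCst 1)) = interp f t ^+ n.
Proof. by elim: n => [|n IHn] /=; rewrite ?scale1r // IHn exprS. Qed.

Lemma interp_serre (C : fieldType) (G : simple_setup C) (X : Type)
    (A : algType Qq) (f : X -> A) (Z : Idx G -> X) i j :
  let m := `|(1 - acart i j)%R|%N in
  interp f (serre Z i j) = \sum_(b < m.+1) ((-1) ^+ b * qbinom (qi i) m b) *: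
    (f (Z i) ^+ b * f (Z j) * f (Z i) ^+ (m - b)).
Proof.
move=> m; rewrite /serre -/m.
elim/big_rec2: _ => /= [|b x t _ <-]; first by rewrite scale0r.
by rewrite !interp_iter mulr_algl.
Qed.

(** A named copy of [val] that carries the linear and the multiplicative structure together, so that
    it serves as an [lrmorphism] and composes with others. *)
Definition subalg_incl (k : fieldType) (A : algType k) (S : set A) (x : subalg S) : A :=
  val x.
HB.instance Definition _ (k : fieldType) (A : algType k) (S : set A) :=
  GRing.Linear.copy (@subalg_incl k A S) (val : {linear subalg S -> A}).
HB.instance Definition _ (k : fieldType) (A : algType k) (S : set A) :=
  GRing.RMorphism.copy (@subalg_incl k A S) (val : {rmorphism subalg S -> A}).

(** * Connectedness of the Dynkin diagram *)

Section LieAlgebra.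
Variables (C : fieldType) (g : lieAlg C).
Implicit Types x y z : g.

Fact lie_linear x : linear (lie x).
Proof. by move=> c y z; rewrite lie_linr. Qed.
HB.instance Definition _ x := GRing.isLinear.Build C g g _ (lie x) (lie_linear x).

Definition ad x : 'End(g) := linfun (lie x).

Lemma adE x y : ad x y = lie x y.
Proof. by rewrite lfunE. Qed.

Lemma ad_linear : linear ad.
Proof.
by move=> c x y; apply/lfunP => z; rewrite !lfunE /= lfunE /= !lfunE lie_linl.
Qed.
HB.instance Definition _ := GRing.isLinear.Build C g _ _ ad ad_linear.

Lemma lieC x y : lie x y = - lie y x.
Proof.
apply/eqP; rewrite -addr_eq0; apply/eqP.
have := lie_alt (x + y); rewrite -!adE !linearD /= !lfunE /= !adE.
by rewrite !lie_alt add0r addr0 addrC.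
Qed.

Lemma lie_leibniz x y z : lie x (lie y z) = lie (lie x y) z + lie y (lie x z).
Proof.
have := lie_jacobi x y z; rewrite [lie z (lie x y)]lieC [lie z x]lieC linearN /=.
by move/eqP; rewrite -addrA -opprD subr_eq0 => /eqP ->; rewrite addrC.
Qed.

Lemma lie0x y : lie 0 y = 0.
Proof. by rewrite -adE linear0 lfunE. Qed.
Lemma lieDx x x' y : lie (x + x') y = lie x y + lie x' y.
Proof. by rewrite -!adE linearD lfunE. Qed.
Lemma lieZx c x y : lie (c *: x) y = c *: lie x y.
Proof. by rewrite -!adE linearZ lfunE. Qed.
Lemma liex0 x : lie x 0 = 0.
Proof. exact: linear0. Qed.
Lemma liexD x y y' : lie x (y + y') = lie x y + lie x y'.
Proof. exact: linearD. Qed.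
Lemma liexZ c x y : lie x (c *: y) = c *: lie x y.
Proof. exact: linearZ. Qed.
Lemma lie_sumx I (r : seq I) P (F : I -> g) y :
  lie (\sum_(i <- r | P i) F i) y = \sum_(i <- r | P i) lie (F i) y.
Proof.
by rewrite -adE linear_sum sum_lfunE; apply: eq_bigr => i _; rewrite adE.
Qed.
End LieAlgebra.

(** * Simultaneous diagonalization of the Cartan subalgebra *)

Section WeightBasis.
Variables (C : fieldType) (g : lieAlg C) (h : {vspace g}).
Hypothesis hP : cartan_subalgebra h.
Local Notation n := (\dim {: g}).
Local Notation e := (vbasis {: g}).

Let e_basis : basis_of fullv e := vbasisP _.

Lemma ad_diag_mx (x : g) :
  ad_diagonalizable x -> diagonalizable (mxof e e (ad x)).
Proof.
move=> [b [b_basis bE]].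
have sz : size b == n by rewrite (size_basis (X := in_tuple b) b_basis).
pose t := Tuple sz; have t_basis : basis_of fullv t by [].
have /fin_all_exists [d dE] : forall i : 'I_n, exists c, lie x t`_i = c *: t`_i.
  by move=> i; apply: bE; rewrite mem_nth ?(eqP sz).
exists (mxof t e \1).
  suff /mulmx1_unit[] : mxof t e \1 *m mxof e t \1 = 1%:M by [].
  by rewrite -mxof_comp // comp_lfun1l mxof1 // (basis_free t_basis).
apply/diagonalizable_forPex; exists (\row_i d i).
apply/simmxP.
  suff /mulmx1_unit[] : mxof t e \1 *m mxof e t \1 = 1%:M by [].
  by rewrite -mxof_comp // comp_lfun1l mxof1 // (basis_free t_basis).
rewrite -mxof_comp // comp_lfun1r.
have -> : diag_mx (\row_i d i) = mxof t t (ad x).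
  apply/row_matrixP => i; rewrite row_diag_mx mxE [RHS]rowE mul_mxof.
  rewrite -(rVofE t_basis) rVofK // adE dE linearZ /=.
  by rewrite (rVofE t_basis).
by rewrite -mxof_comp // comp_lfun1l.
Qed.

(** The operators [ad y], for [y] in a basis of [h], commute by the Jacobi identity and are
    diagonalizable, so a single matrix [P] diagonalizes them all; its rows are the basis. *)
Lemma weight_basis : exists (b : n.-tuple g) (w : 'I_n -> dual h),
  basis_of fullv b /\
  forall (k : 'I_n) (y : subvs_of h), lie (vsval y) b`_k = (w k y : C) *: b`_k.
Proof.
have [habel _ hdiag] := hP.
pose A (y : g) := mxof e e (ad y).
have /(codiagonalizableP [seq A y | y <- vbasis h]) :
  {in [seq A y | y <- vbasis h] &, forall A B, comm_mx A B} /\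
  {in [seq A y | y <- vbasis h], forall A, diagonalizable A}.
  split=> [_ _ /mapP[x xh ->] /mapP[y yh ->]|_ /mapP[x xh ->]].
    rewrite /comm_mx -!mxof_comp //; congr mxof; apply/lfunP => z.
    rewrite !comp_lfunE !adE lie_leibniz [lie y x]habel ?vbasis_mem //.
    by rewrite lie0x add0r.
  by apply: ad_diag_mx; apply: hdiag; rewrite vbasis_mem.
move=> [P Pu /allP PA].
pose b := [tuple vecof e (row k P) | k < n].
have bE (k : 'I_n) : b`_k = vecof e (row k P) by rewrite -tnth_nth tnth_mktuple.
have /fin_all_exists [d dE] : forall j : 'I_(\dim h), exists D : 'rV[C]_n,
    P *m A (vbasis h)`_j = diag_mx D *m P.
  move=> j; have /PA /diagonalizable_forPex[D /(simmxP Pu) DE] :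
     A (vbasis h)`_j \in [seq A y | y <- vbasis h].
    by apply: map_f; rewrite mem_nth ?size_tuple.
  by exists D.
(* The eigenvalues are known on a basis of [h]; the weight is their linear extension. *)
pose wf k (y : subvs_of h) : C^o :=
  \sum_j coord (vbasis h) j (vsval y) * d j 0 k.
have wl k : linear (wf k).
  move=> c y z; rewrite /wf scaler_sumr -big_split; apply: eq_bigr => j _ /=.
  by rewrite linearP /= mulrDl -[c * _ * _]mulrA.
pose wL k := HB.pack (wf k) (GRing.isLinear.Build C (subvs_of h) C^o _ (wf k) (wl k))
   : {linear subvs_of h -> C^o}.
exists b, (fun k => linfun (wL k)); split.
  rewrite basisEfree subvf size_tuple leqnn andbT andbT.
  have bs : span b = fullv; last first.
    by rewrite /free bs size_tuple.
  apply/eqP; rewrite eqEsubv subvf /=; apply/subvP => x _.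
  rewrite -[x](rVofK e_basis) -[rVof e x](mulmxKV Pu) mulmx_sum_row linear_sum.
  apply: memv_suml => k _; rewrite linearZ memvZ //= -bE memv_span // mem_nth //.
  by rewrite size_tuple.
move=> k y; rewrite lfunE /= /wf {1}(coord_vbasis (valP y)) /= lie_sumx scaler_suml.
apply: eq_bigr => j _; rewrite lieZx -scalerA; congr (_ *: _).
rewrite bE -adE; apply: (can_inj (rVofK e_basis)).
rewrite (rVof_app e e_basis) vecofK // -/(A _) -row_mul dE.
rewrite linearZ /= vecofK //.
by rewrite row_mul row_diag_mx -scalemxAl -rowE.
Qed.

End WeightBasis.

(** * The invariant form on [h], roots and root vectors *)

Section RootData.
Variables (C : numFieldType) (G : simple_setup C).
Local Notation g := (sgl G).
Local Notation h := (csa G).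
Local Notation wt := (weight G).
Local Notation B := (@bform _ G).
Local Notation al := (@alpha _ G).

Definition weight_vector (mu : wt) (x : g) : Prop :=
  forall y : subvs_of h, lie (vsval y) x = (mu y : C) *: x.

Fact bform_linear x : linear (B x : g -> C^o).
Proof.
have [Bl Bs _ _] := bformP G => c y z.
by rewrite Bs Bl Bs [B z x]Bs.
Qed.
HB.instance Definition _ x :=
  GRing.isLinear.Build C g C^o _ (B x : g -> C^o) (bform_linear x).

Lemma bformC x y : B x y = B y x.
Proof. by have [_ -> _ _] := bformP G. Qed.
Lemma bform0x y : B 0 y = 0.
Proof. by rewrite bformC linear0. Qed.
Lemma bformDx x x' y : B (x + x') y = B x y + B x' y.
Proof. by rewrite bformC linearD /= ![B y _]bformC. Qed.
Lemma bformNx x y : B (- x) y = - B x y.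
Proof. by rewrite bformC linearN /= ![B y _]bformC. Qed.
Lemma bformZx c x y : B (c *: x) y = c * B x y.
Proof. by rewrite bformC linearZ /= ![B y _]bformC. Qed.
Lemma bformxZ c x y : B x (c *: y) = c * B x y.
Proof. exact: linearZ. Qed.
Lemma bform_lie x y z : B (lie x y) z = B x (lie y z).
Proof. by have [_ _ -> _] := bformP G. Qed.

Lemma dual_neq0 (mu : wt) : mu <> 0 -> exists y, mu y <> 0.
Proof.
move=> mu0; apply: contrapT => /forallNP mu_y; apply: mu0.
by apply/lfunP => y; rewrite lfunE /=; apply: contrapT; apply: mu_y.
Qed.

(** Invariance moves [ad z] from one argument to the other, so [(mu + nu) z * B x y = 0] for all [z]
    in [h]. *)
Lemma bform_orth mu nu x y :
  weight_vector mu x -> weight_vector nu y -> mu + nu <> 0 -> B x y = 0.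
Proof.
move=> wx wy /dual_neq0[z]; rewrite lfunE /= => /eqP nz.
apply/eqP; rewrite -(mulrI_eq0 _ (mulfI nz)) mulrDl; apply/eqP.
have := bform_lie x (vsval z) y; rewrite wy lieC wx bformNx bformZx bformxZ.
by move=> <-; rewrite subrr.
Qed.

(** Adjoining to [h] a vector that commutes with it gives an abelian subspace, which is [h] by
    maximality. *)
Lemma weight0_csa x : weight_vector 0 x -> x \in h.
Proof.
have [habel hmax _] := csaP G => wx.
have hx y : y \in h -> lie y x = 0.
  by move=> yh; rewrite -(vsprojK yh) wx lfunE scale0r.
suff ha : lie_abelian (h + <[x]>)%VS.
  rewrite -(hmax _ ha (addvSl _ _)) -[X in X \in _]add0r.
  by apply: memv_add; rewrite ?mem0v ?memv_line.
move=> y z /memv_addP[y1 y1h [y2 /vlineP[c ->] ->]] /memv_addP[z1 z1h [z2 /vlineP[d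
  ->] ->]].
rewrite lieDx lieZx !liexD !liexZ habel // hx // [lie x z1]lieC hx // lie_alt.
by rewrite !(oppr0, scaler0, addr0).
Qed.

Lemma csa_weight0 x : x \in h -> weight_vector 0 x.
Proof.
by have [habel _ _] := csaP G => xh y; rewrite lfunE scale0r habel // subvsP.
Qed.

Lemma eq_on_weight_vectors (V : lmodType C) (f f' : {linear g -> V}) :
  (forall mu x, weight_vector mu x -> f x = f' x) -> f =1 f'.
Proof.
move=> ff x; have [b [w [b_basis bw]]] := weight_basis (csaP G).
rewrite (coord_basis b_basis (memvf x)) !linear_sum; apply: eq_bigr => k _.
by rewrite !linearZ /= (ff (w k)).
Qed.

(** Vectors of nonzero weight are orthogonal to [h] anyway, so orthogonality to [h] is orthogonality
    to all of [g]. *)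
Lemma csa_nondeg (t : subvs_of h) :
  (forall y : subvs_of h, B (vsval t) (vsval y) = 0) -> t = 0.
Proof.
move=> tB; apply: val_inj => /=; have [_ _ _ nd] := bformP G; apply: nd.
apply: (eq_on_weight_vectors (f := B (vsval t)) (f' := \0)) => mu x wx /=.
have [mu0|mu0] := pselect (mu = 0).
  have xh : x \in h by apply: weight0_csa; rewrite -mu0.
  by rewrite -(vsprojK xh) tB.
by apply: (bform_orth (csa_weight0 (subvsP t)) wx); rewrite add0r.
Qed.

Let bdual_fun (t y : subvs_of h) : C^o := B (vsval t) (vsval y).
Fact bdual_linear t : linear (bdual_fun t).
Proof. by move=> c y z; rewrite /bdual_fun linearP. Qed.
HB.instance Definition _ t :=
  GRing.isLinear.Build C (subvs_of h) C^o _ (bdual_fun t) (bdual_linear t).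
Let bdual (t : subvs_of h) : wt := linfun (bdual_fun t).
Fact bdual_is_linear : linear bdual.
Proof.
move=> c s t; apply/lfunP => y; rewrite !lfunE /= !lfunE /= !lfunE /=.
by rewrite /bdual_fun bformDx bformZx.
Qed.
HB.instance Definition _ := GRing.isLinear.Build C _ wt _ bdual bdual_is_linear.

Lemma bdual_surj (mu : wt) : exists t, bdual t = mu.
Proof.
have k0 : lker (linfun bdual) = 0%VS.
  apply/eqP; rewrite -subv0; apply/subvP => t; rewrite memv_ker lfunE memv0 => /eqP t0.
  apply/eqP; apply: csa_nondeg => y.
  by move/(congr1 (fun f : wt => f y)): t0; rewrite !lfunE.
have im : limg (linfun bdual) = fullv.
  apply/eqP; rewrite eqEdim subvf /= limg_dim_eq ?k0 ?capv0 // !dimvf.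
  by rewrite /dim /= /dim /= muln1.
have : mu \in limg (linfun bdual) by rewrite im memvf.
by case/memv_imgP => t _ ->; exists t; rewrite lfunE.
Qed.

Local Notation tv := (@dual_vec C (sgl G) (csa G) B).

(** Surjectivity of [bdual] excludes the default value of [xget]. *)
Lemma dual_vecE (mu : wt) (y : subvs_of h) : B (vsval (tv mu)) (vsval y) = mu y.
Proof.
rewrite /dual_vec; case: xgetP => [t _ /(_ y) //|no].
have [t tE] := bdual_surj mu.
by case: (no t) => z; rewrite -tE lfunE.
Qed.

Lemma dual_vec_uniq (mu : wt) (t : subvs_of h) :
  (forall y : subvs_of h, B (vsval t) (vsval y) = mu y) -> tv mu = t.
Proof.
move=> tE; apply/eqP; rewrite -subr_eq0; apply/eqP/csa_nondeg => y.
by rewrite linearB /= bformDx bformNx dual_vecE tE subrr.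
Qed.

Fact dual_vec_linear : linear tv.
Proof.
move=> c mu nu; apply: dual_vec_uniq => y.
by rewrite linearP /= bformDx bformZx !dual_vecE !lfunE /= lfunE.
Qed.
HB.instance Definition _ := GRing.isLinear.Build C wt _ _ tv dual_vec_linear.

Lemma pairE (mu nu : wt) : pair mu nu = mu (tv nu).
Proof. by rewrite /pair /dual_form dual_vecE. Qed.

Lemma pairC (mu nu : wt) : pair mu nu = pair nu mu.
Proof. exact: bformC. Qed.

Fact pair_linear (mu : wt) : linear (pair mu : wt -> C^o).
Proof. by move=> c nu nu'; rewrite !pairE linearP /= linearP. Qed.
HB.instance Definition _ mu :=
  GRing.isLinear.Build C wt C^o _ (pair mu : wt -> C^o) (pair_linear mu).

(** The line through a central vector is an ideal, and it is not all of [g] because the bracket is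
    nonzero. *)
Lemma center0 x : (forall y : g, lie x y = 0) -> x = 0.
Proof.
move=> xc; have [[u [v uv]] simp] := sgl_simple G.
case: (simp <[x]>%VS) => [y z /vlineP[c ->]|/eqP|xf].
- by rewrite liexZ lieC xc oppr0 scaler0 mem0v.
- rewrite -subv0 => /subvP/(_ x (memv_line x)); by rewrite memv0 => /eqP.
case: uv; have : u \in <[x]>%VS by rewrite xf memvf.
by case/vlineP => c ->; rewrite lieZx xc scaler0.
Qed.

Lemma root_alpha mu : is_root mu -> exists (c : Idx G -> int),
  mu = \sum_i al i *~ c i /\ ((forall i, 0 <= c i) \/ (forall i, c i <= 0)).
Proof.
have [_ _ rP] := alphaP G => /rP[c [->|->]].
  by exists (fun i => c i : int); split=> //; left.
exists (fun i => - (c i : int)); split; last by right=> i; rewrite oppr_le0.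
by rewrite -sumrN; apply: eq_bigr => i _; rewrite mulrNz.
Qed.

(** All roots vanish at such a [y], so [ad y] kills every weight vector and [y] is central. *)
Lemma alpha_sep_csa (y : subvs_of h) : (forall i, al i y = 0) -> y = 0.
Proof.
move=> ay; apply: val_inj => /=; apply: center0 => z; rewrite -adE.
rewrite [RHS](_ : _ = (0 : 'End(g)) z); last by rewrite lfunE.
apply: (eq_on_weight_vectors (f := ad (vsval y)) (f' := (0 : 'End(g)))).
move=> mu x wx; rewrite /= adE wx lfunE /=.
have [->|x0] := eqVneq x 0; first by rewrite scaler0.
have [->|mu0] := pselect (mu = 0); first by rewrite lfunE scale0r.
have /root_alpha[c [-> _]] : is_root mu by split=> //; exists x => //; apply/eqP.
rewrite sum_lfunE big1 ?scale0r // => i _.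
by rewrite -scaler_int lfunE /= ay scaler0.
Qed.

Lemma pair_alpha_eq0 (mu : wt) : (forall i, pair mu (al i) = 0) -> mu = 0.
Proof.
move=> mu0; have t0 : tv mu = 0.
  by apply: alpha_sep_csa => i; rewrite -pairE pairC.
by apply/lfunP => y; rewrite -dual_vecE t0 bform0x lfunE.
Qed.

(** By nondegeneracy some vector of the weight basis pairs with [e], and orthogonality forces its
    weight to be [- mu]. After scaling to [B e f = 1], invariance shows that [lie e f] represents
    [mu] on [h]. *)
Lemma opposite_root_vector mu e : mu <> 0 -> e <> 0 -> weight_vector mu e ->
  exists2 f, weight_vector (- mu) f & lie e f = vsval (tv mu).
Proof.
move=> mu0 e0 we; have [b [w [b_basis bw]]] := weight_basis (csaP G).
have [k /eqP Bk] : exists k : 'I_(\dim {:g}), B e b`_k <> 0.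
  apply: contrapT => /forallNP Be; apply: e0; have [_ _ _ nd] := bformP G.
  apply: nd => y; rewrite (coord_basis b_basis (memvf y)) linear_sum big1 // => k _.
  by rewrite linearZ /= (contrapT (Be k)) scaler0.
have wk : w k = - mu.
  apply: contrapT => wk; case/eqP: Bk; apply: (bform_orth we (bw k)).
  by move/eqP; rewrite addrC addr_eq0 => /eqP.
pose f := (B e b`_k)^-1 *: b`_k; have wf : weight_vector (- mu) f.
  by move=> y; rewrite liexZ bw wk !scalerA mulrC.
have Bef : B e f = 1 by rewrite bformxZ mulVf.
exists f => //; clearbody f.
have efh : lie e f \in h.
  apply: weight0_csa => y; rewrite lie_leibniz we wf lieZx liexZ opp_lfunE zero_lfunE.
  by rewrite -scalerDl subrr !scale0r.
rewrite -(vsprojK efh); congr vsval; apply/esym/dual_vec_uniq => y.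
rewrite vsprojK // bform_lie lieC wf opp_lfunE scaleNr opprK.
by rewrite bformxZ Bef mulr1.
Qed.

End RootData.

(** * Raising, lowering and positivity of the form *)

Section Connectivity.
Variables (C : numFieldType) (G : simple_setup C).
Local Notation g := (sgl G).
Local Notation h := (csa G).
Local Notation wt := (weight G).
Local Notation B := (@bform _ G).
Local Notation al := (@alpha _ G).
Local Notation tv := (@dual_vec C (sgl G) (csa G) B).
Local Notation n := (\dim {: g}).

Lemma alpha_free (c c' : Idx G -> int) :
  \sum_i al i *~ c i = \sum_i al i *~ c' i -> c =1 c'.
Proof.
have [fr _ _] := alphaP G => /eqP; rewrite -subr_eq0 -sumrB => /eqP cc i.
apply/eqP; rewrite -subr_eq0 -(intr_eq0 C); apply/eqP; move: i; apply: fr.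
by rewrite -[RHS]cc; apply: eq_bigr => i _; rewrite scaler_int mulrzBr.
Qed.

Lemma alpha_root i : is_root (al i).
Proof. by have [_ + _] := alphaP G; apply. Qed.

Definition aform (i j : Idx G) : int := (dsym i)%:Z * acart i j.

Lemma pair_alpha i j : pair (al i) (al j) = (aform i j)%:~R.
Proof. by rewrite /pair acartP intrM. Qed.

Lemma aform_diag i : aform i i = (2 * dsym i)%N.
Proof. by apply: (@intr_inj C); rewrite -pair_alpha /pair dsymP. Qed.

Lemma pair_alpha_gt0 i : 0 < pair (al i) (al i).
Proof. by rewrite pair_alpha aform_diag ltr0z ltz_nat muln_gt0 /= dsym_gt0. Qed.

Lemma pair_sum_alpha (c : Idx G -> int) (mu : wt) :
  pair mu (\sum_i al i *~ c i) = \sum_i pair mu (al i) * (c i)%:~R.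
Proof.
rewrite linear_sum; apply: eq_bigr => i _.
by rewrite -scaler_int linearZ /= mulrC.
Qed.

Lemma pairDx (mu mu' nu : wt) : pair (mu + mu') nu = pair mu nu + pair mu' nu.
Proof. by rewrite !pairE add_lfunE. Qed.

Lemma pair_lattice (c c' : Idx G -> int) :
  exists z : int, pair (\sum_i al i *~ c i) (\sum_i al i *~ c' i) = z%:~R.
Proof.
exists (\sum_i (\sum_j aform i j * c j) * c' i).
rewrite pair_sum_alpha rmorph_sum; apply: eq_bigr => i _.
rewrite rmorphM /= pairC pair_sum_alpha rmorph_sum; congr (_ * _).
by apply: eq_bigr => j _; rewrite pair_alpha rmorphM.
Qed.

Lemma weight_vector_lie mu nu x y : weight_vector mu x -> weight_vector nu y ->
  weight_vector (mu + nu) (lie (x : g) y).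
Proof.
by move=> wx wy z; rewrite lie_leibniz wx wy lieZx liexZ add_lfunE scalerDl.
Qed.

Lemma weight_vector_dual mu nu (x : g) : weight_vector mu x ->
  lie (vsval (tv nu)) x = pair mu nu *: x.
Proof. by move=> ->; rewrite pairE. Qed.

(** An element of [h] scales the coordinate [k] by [w k] and the vector [x] by [mu]; a nonzero
    coordinate forces the two to agree. *)
Lemma weight_coord (b : n.-tuple g) (w : 'I_n -> wt) mu x k :
  basis_of fullv b -> (forall k : 'I_n, weight_vector (w k) b`_k) ->
  weight_vector mu x -> coord b k x <> 0 -> w k = mu.
Proof.
move=> b_basis bw wx xk; apply/lfunP => y; apply/eqP; rewrite -subr_eq0.
have fb : free b by apply: basis_free b_basis.
have : coord b k (lie (vsval y) x) = (w k y : C) * coord b k x.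
  rewrite [in LHS](coord_basis b_basis (memvf x)) -adE !linear_sum (bigD1 k) //=.
  rewrite big1 => [|l lk]; rewrite linearZ /= adE bw linearZ /= linearZ /=.
    by rewrite coord_free // eqxx addr0 mulr1 mulrC.
  by rewrite coord_free // ?(eq_sym k l) (negPf lk) !mulr0.
rewrite wx linearZ /= => /eqP; rewrite eq_sym -subr_eq0 -mulrBl mulf_eq0.
by case/orP => // /eqP.
Qed.

Lemma nonzero_coord (b : n.-tuple g) (x : g) : basis_of fullv b -> x <> 0 ->
  exists k, coord b k x <> 0.
Proof.
move=> b_basis x0; apply: contrapT => /forallNP bx; apply: x0.
rewrite (coord_basis b_basis (memvf x)) big1 // => k _.
by rewrite (contrapT (bx k)) scale0r.
Qed.

(* [f e^(m+1) x = - (sum_(j <= m) (be + j a, a)) e^m x] with positive sums, so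
   the vectors [e^m x] would be infinitely many nonzero vectors of distinct
   weights. *)
Lemma sl2_raise_lower (a be : wt) (e f x : g) :
  weight_vector a e -> lie e f = vsval (tv a) ->
  0 < pair a a -> weight_vector be x -> x <> 0 -> 0 < pair be a ->
  lie e (lie f x) <> 0.
Proof.
move=> we ef a0 wx x0 ba efx0.
pose X m := iter m (lie e) x.
have wX m : weight_vector (be + a *+ m) (X m).
  elim: m => [|m IHm] /=; first by rewrite addr0.
  by rewrite mulrS addrCA; apply: weight_vector_lie.
have fX m : exists2 s : C, 0 < s & lie f (X m.+1) = - s *: X m.
  elim: m => [|m [s s0 IHm]].
    exists (pair be a) => //; have := lie_leibniz e f x.
    by rewrite efx0 ef (weight_vector_dual _ wx) scaleNr => /esym/eqP;
       rewrite addrC addr_eq0 => /eqP.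
  exists (s + pair (be + a *+ m.+1) a).
    by rewrite pairDx addr_gt0 // ltr_wpDr // pairC linearMn mulrn_wge0 // ltW.
  have := lie_leibniz e f (X m.+1).
  rewrite IHm ef (weight_vector_dual _ (wX m.+1)) liexZ -[lie e (X m)]/(X m.+1).
  move/eqP; rewrite addrC -subr_eq -scalerBl => /eqP <-.
  by rewrite opprD.
have X0 m : X m <> 0.
  elim: m => // m IHm Xm; have [s s0] := fX m.
  rewrite Xm liex0 => /esym/eqP; rewrite scaler_eq0 oppr_eq0 gt_eqF //=.
  by move/eqP.
have [b [w [b_basis bw]]] := weight_basis (csaP G).
(* The first [n + 1] vectors [X m] have distinct weights, all found among the [n] weights of the
   basis: a pigeonhole contradiction. *)
have /fin_all_exists[k kE] : forall m : 'I_n.+1, exists k : 'I_n, w k = be + a *+ m.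
  move=> m; have [k kX] := nonzero_coord b_basis (X0 m).
  by exists k; apply: (weight_coord b_basis bw (wX m) kX).
have inj : injective k.
  move=> m m' kk; apply: val_inj => /=.
  have := kE m; rewrite kk kE => /addrI /(congr1 (pair a)) /eqP.
  rewrite !linearMn /= -subr_eq0 => /eqP E.
  apply/eqP; rewrite -(eqr_nat C); apply/eqP; apply: (mulfI (lt0r_neq0 a0)).
  by rewrite !mulr_natr; apply/esym/eqP; rewrite -subr_eq0 E.
by have := leq_card _ inj; rewrite !card_ord ltnn.
Qed.

(** The left-hand side is the trace form of the vectors dual to [be] and [al i]. The latter is some
    [lie e f], and invariance of the trace moves the bracket to [[t_be, e]], which is
    [pair be (al i) *: e]; the factor left is the trace form of [e] and [f]. *)
Lemma trace_form_alpha (b : n.-tuple g) (w : 'I_n -> wt) :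
  basis_of fullv b -> (forall k : 'I_n, weight_vector (w k) b`_k) ->
  forall i, exists k : C, forall be : wt,
    \sum_l pair (w l) be * pair (w l) (al i) = pair be (al i) * k.
Proof.
move=> b_basis bw i; have fb : free b by apply: basis_free b_basis.
pose M (x : g) := mxof b b (ad x).
(* Matrices act on row vectors, so [M] reverses products. *)
have MM x y : M (lie x y) = M y *m M x - M x *m M y.
  rewrite /M -!mxof_comp // -linearB /=; congr mxof; apply/lfunP => z.
  by rewrite add_lfunE opp_lfunE !comp_lfunE !adE lie_leibniz addrK.
have Mt mu : M (vsval (tv mu)) = diag_mx (\row_l pair (w l) mu).
  apply/row_matrixP => l; rewrite row_diag_mx mxE [LHS]rowE mul_mxof.
  rewrite -(rVofE b_basis) rVofK // adE (weight_vector_dual _ (bw l)) linearZ /=.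
  by rewrite (rVofE b_basis).
have [al0 [e e0 we]] := alpha_root i.
have [f wf ef] := opposite_root_vector al0 e0 we.
exists (\tr (M e *m M f)) => be.
transitivity (\tr (M (vsval (tv be)) *m M (vsval (tv (al i))))).
  rewrite !Mt mulmx_diag mxtrace_diag; apply: eq_bigr => l _.
  by rewrite !mxE.
rewrite -ef MM mulmxBr linearB /= [X in X - _](_ : _ = \tr (M e *m M (vsval (tv
  be)) *m M f)).
  rewrite mulmxA -linearB /= -mulmxBl -MM (weight_vector_dual _ we) pairC.
  by rewrite /M linearZ /= linearZ /= -scalemxAl linearZ.
by rewrite mulmxA mxtrace_mulC mulmxA.
Qed.

Lemma weight_pair_int (mu : wt) (x : g) (c : Idx G -> int) :
  x <> 0 -> weight_vector mu x ->
  exists z : int, pair mu (\sum_i al i *~ c i) = z%:~R.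
Proof.
move=> x0 wx; have [->|mu0] := pselect (mu = 0).
  by exists 0; rewrite pairC linear0.
have [c' [-> _]] : exists c' : Idx G -> int, mu = \sum_i al i *~ c' i /\
   ((forall i, 0 <= c' i) \/ (forall i, c' i <= 0)).
  by apply: root_alpha; split=> //; exists x.
exact: pair_lattice.
Qed.

(** Squares in a [numFieldType] may fail to be nonnegative, as in the complex numbers; this is why
    integrality of the pairings matters. *)
Lemma int_sqr_ge0 (x : C) : (exists z : int, x = z%:~R) -> 0 <= x * x.
Proof. by move=> [z ->]; rewrite -intrM ler0z sqr_ge0. Qed.

(** The factors [k i] are nonnegative, as the case [be = al i] of the trace form shows. Expanding
    one [be] gives [\sum_l pair (w l) be ^+ 2 = \sum_i c i * pair be (al i) * k i]. If no [i] were
    suitable, the right-hand side would be at most 0, all weights of [g] would be orthogonal to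
    [be], and its dual vector would be central. *)
Lemma pos_pair_alpha (c : Idx G -> nat) : \sum_i al i *+ c i <> 0 ->
  exists2 i, (0 < c i)%N & 0 < pair (\sum_i al i *+ c i) (al i).
Proof.
set be := \sum_i _ => be0; apply: contrapT => noi.
have [b [w [b_basis bw]]] := weight_basis (csaP G).
have b0 (l : 'I_n) : b`_l <> 0.
  by apply/eqP; apply: basis_not0 b_basis _; rewrite mem_nth ?size_tuple.
have beE : be = \sum_i al i *~ c i by [].
have alE i : al i = \sum_j al j *~ (i == j : nat).
  rewrite (bigD1 i) //= eqxx big1 ?addr0 // => j ji.
  by rewrite eq_sym (negPf ji).
have /fin_all_exists[k kE] := trace_form_alpha b_basis bw.
have k_ge0 i : 0 <= k i.
  rewrite -(pmulr_rge0 _ (pair_alpha_gt0 i)) -kE; apply: sumr_ge0 => l _.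
  by apply: int_sqr_ge0; rewrite [al i]alE; apply: weight_pair_int (b0 l) (bw l).
have sq_ge0 l : 0 <= pair (w l) be * pair (w l) be.
  by apply: int_sqr_ge0; rewrite beE; apply: weight_pair_int (b0 l) (bw l).
have sum0 : \sum_l pair (w l) be * pair (w l) be = 0.
  apply: le_anti; rewrite sumr_ge0 ?andbT //.
  have -> : \sum_l pair (w l) be * pair (w l) be =
      \sum_i (pair be (al i) * k i) * (c i)%:R.
    under [RHS]eq_bigr => i _ do rewrite -kE mulr_suml.
    rewrite exchange_big; apply: eq_bigr => l _ /=.
    rewrite {2}beE pair_sum_alpha mulr_sumr.
    by apply: eq_bigr => i _; rewrite mulrA.
  rewrite sumr_le0 // => i _; have [->|ci] := posnP (c i); first by rewrite mulr0.
  apply: mulr_le0_ge0 => //; apply: mulr_le0_ge0 => //.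
  have [z zE] : exists z : int, pair be (al i) = z%:~R.
    by rewrite beE [al i]alE; apply: pair_lattice.
  rewrite zE lerz0 leNgt; apply/negP => z0; apply: noi; exists i => //.
  by rewrite zE ltr0z.
have wbe l : pair (w l) be = 0.
  move/eqP: sum0; rewrite psumr_eq0 // => /allP /(_ l (mem_index_enum _)) /=.
  by rewrite mulf_eq0 orbb => /eqP.
apply: be0; apply/lfunP => y; rewrite -dual_vecE.
have -> : tv be = 0; last by rewrite bform0x lfunE.
apply: val_inj => /=; apply: center0 => z; rewrite -adE.
rewrite (coord_basis b_basis (memvf z)) linear_sum big1 // => l _.
by rewrite linearZ /= adE (weight_vector_dual _ (bw l)) wbe scale0r scaler0.
Qed.

End Connectivity.

(** * Orthogonal splittings of the simple roots *)

Section Dynkin.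
Variables (C : numFieldType) (G : simple_setup C).
Local Notation g := (sgl G).
Local Notation h := (csa G).
Local Notation wt := (weight G).
Local Notation B := (@bform _ G).
Local Notation al := (@alpha _ G).
Local Notation tv := (@dual_vec C (sgl G) (csa G) B).
Local Notation n := (\dim {: g}).

Definition supported (J : pred (Idx G)) (mu : wt) : Prop :=
  exists2 c : Idx G -> int, mu = \sum_i al i *~ c i & forall i, ~~ J i -> c i = 0.

Definition orth_split (J : pred (Idx G)) : Prop :=
  forall i j, J i -> ~~ J j -> pair (al i) (al j) = 0.

Lemma orth_splitC J : orth_split J -> orth_split (predC J).
Proof. by move=> oJ i j nJi /negPn Jj; rewrite pairC oJ. Qed.

Lemma supported_orth J mu j : orth_split J -> supported J mu -> ~~ J j ->
  pair mu (al j) = 0.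
Proof.
move=> oJ [c -> cJ] Jj; rewrite pairC pair_sum_alpha big1 // => i _.
have [Ji|nJi] := boolP (J i); first by rewrite pairC oJ // mul0r.
by rewrite cJ // mulr0.
Qed.

Lemma supportedD J mu nu : supported J mu -> supported J nu -> supported J (mu + nu).
Proof.
move=> [c -> cJ] [d -> dJ]; exists (fun i => c i + d i) => [|i Ji].
  by rewrite -big_split; apply: eq_bigr => i _; rewrite mulrzDr.
by rewrite cJ // dJ.
Qed.

Lemma supportedN J mu : supported J mu -> supported J (- mu).
Proof.
move=> [c -> cJ]; exists (fun i => - c i) => [|i Ji]; last by rewrite cJ // oppr0.
by rewrite -sumrN; apply: eq_bigr => i _; rewrite mulrNz.
Qed.

Lemma supported_disjoint J mu : supported J mu -> supported (predC J) mu -> mu = 0.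
Proof.
move=> [c -> cJ] [d cd dJ]; apply: big1 => i _.
have [Ji|nJi] := boolP (J i); last by rewrite cJ.
by rewrite (alpha_free cd) dJ //= Ji.
Qed.

Lemma alpha_delta i : al i = \sum_j al j *+ (j == i).
Proof.
rewrite (bigD1 i) //= eqxx big1 ?addr0 // => j /negPf ->.
by rewrite mulr0n.
Qed.

Lemma supported_alpha (J : pred (Idx G)) i : J i -> supported J (al i).
Proof.
move=> Ji; exists (fun j => (j == i : nat) : int); first exact: alpha_delta.
by move=> j Jj; have [ji|//] := eqVneq j i; rewrite ji Ji in Jj.
Qed.

(* A mixed root [ga + alpha_i], with [ga] supported off [i], would make
   [ga - alpha_i] a root with coefficients of both signs. *)
Lemma add_alpha_supported (J : pred (Idx G)) (c : Idx G -> nat) i (x e f : g) :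
  orth_split J -> (forall j, ~~ J j -> c j = 0%N) -> ~~ J i ->
  weight_vector (al i) e -> weight_vector (- al i) f -> lie e f = vsval (tv (al i)) ->
  weight_vector (\sum_j al j *+ c j + al i) x -> x <> 0 ->
  \sum_j al j *+ c j = 0.
Proof.
set ga := \sum_j _ => oJ cJ nJi we wf ef wx x0.
have d0 := pair_alpha_gt0 i.
have gai : pair ga (al i) = 0.
  by apply: (supported_orth (J := J)) => //; exists (fun j => c j : int) => // j /cJ ->.
have bei : 0 < pair (ga + al i) (al i) by rewrite pairDx gai add0r.
have efx := sl2_raise_lower we ef d0 wx x0 bei.
pose y := lie f x; have wy : weight_vector ga y.
  by have := weight_vector_lie wf wx; rewrite addrC addrK.
(* Since [ga] is orthogonal to [al i], [lie e f] kills [y]. Were [lie f y] zero, [f] would kill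
   [lie e y], a nonzero vector of weight [ga + al i], against [sl2_raise_lower]. *)
have fy0 : lie f y <> 0.
  move=> fy; have wey : weight_vector (ga + al i) (lie e y).
    by rewrite addrC; apply: weight_vector_lie.
  have fey : lie f (lie e y) = 0.
    have := lie_leibniz e f y; rewrite fy ef (weight_vector_dual _ wy) gai.
    by rewrite liex0 scale0r add0r.
  by apply: (sl2_raise_lower we ef d0 wey) => //; rewrite fey liex0.
have wfy := weight_vector_lie wf wy.
have gaE : - al i + ga = \sum_j al j *~ ((c j)%:Z - (j == i)%:Z).
  rewrite alpha_delta addrC -sumrB; apply: eq_bigr => j _.
  by rewrite mulrzBr.
have ci : c i = 0%N by apply: cJ.
have rt : is_root (- al i + ga).
  split; last by exists (lie f y).
  move=> z; have : \sum_j al j *~ ((c j)%:Z - (j == i)%:Z) = \sum_j al j *~ 0.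
    by rewrite -gaE z big1.
  by move/alpha_free/(_ i); rewrite ci eqxx.
have [d [dE sgnd]] := root_alpha rt.
have cd j : d j = (c j)%:Z - (j == i)%:Z.
  exact: (alpha_free (etrans (esym dE) gaE)).
case: sgnd => sd; first by have := sd i; rewrite cd ci eqxx.
apply: big1 => j _; have := sd j; rewrite cd.
have [->|ji] := eqVneq j i; first by rewrite ci.
by rewrite subr0 lez_nat leqn0 => /eqP ->.
Qed.

(** Induction on the height. Some [al i] in the support pairs positively with the root, so [f]
    lowers [x] to a nonzero vector, whose weight lies on one side of the splitting. If [i] is on the
    other side, [add_alpha_supported] leaves only [al i] itself. *)
Lemma pos_root_supported (J : pred (Idx G)) (c : Idx G -> nat) (x : g) : orth_split J ->
  weight_vector (\sum_i al i *+ c i) x -> x <> 0 ->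
  supported J (\sum_i al i *+ c i) \/ supported (predC J) (\sum_i al i *+ c i).
Proof.
move=> oJ; have [N] := ubnP (\sum_i c i)%N.
elim: N => // N IHN in c x *; rewrite ltnS => cN wx x0.
have [be0|be0] := pselect (\sum_i al i *+ c i = 0).
  by left; exists (fun=> 0) => //; rewrite be0 big1.
have [i ci bei] := pos_pair_alpha be0.
have [al0 [e e0 we]] := alpha_root i.
have [f wf ef] := opposite_root_vector al0 e0 we.
have d0 := pair_alpha_gt0 i.
pose c' j := (c j - (j == i))%N.
have ccE j : c j = (c' j + (j == i))%N.
  by rewrite subnK //; have [->|] := eqVneq j i.
have beE : \sum_j al j *+ c j = \sum_j al j *+ c' j + al i.
  rewrite [in RHS](alpha_delta i) -big_split; apply: eq_bigr => j _.
  by rewrite ccE mulrnDr.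
have efx := sl2_raise_lower we ef d0 wx x0 bei.
have fx0 : lie f x <> 0 by move=> fx; rewrite fx liex0 in efx.
have wfx : weight_vector (\sum_j al j *+ c' j) (lie f x).
  by have := weight_vector_lie wf wx; rewrite beE addrC addrK.
have c'N : (\sum_j c' j < N)%N.
  apply: leq_trans cN; under [ltnRHS]eq_bigr => j _ do rewrite ccE.
  rewrite big_split /= -[ltnLHS]addn0 ltn_add2l.
  by rewrite (bigD1 i) //= eqxx.
rewrite beE in wx *.
(* [K] stands for [J] or its complement, whichever supports the lowered weight. *)
have key K : orth_split K -> supported K (\sum_j al j *+ c' j) ->
    supported K (\sum_j al j *+ c' j + al i) \/
    supported (predC K) (\sum_j al j *+ c' j + al i).
  move=> oK sK; have [Ki|nKi] := boolP (K i).
    by left; apply: supportedD => //; apply: supported_alpha.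
  right; have -> : \sum_j al j *+ c' j = 0.
    apply: (add_alpha_supported oK _ nKi we wf ef wx x0) => j nKj.
    have [d dE dK] := sK; have := alpha_free (c := fun j => c' j : int) dE j.
    by rewrite dK // => -[].
  by rewrite add0r; apply: supported_alpha.
case: (IHN c' _ c'N wfx fx0) => [/(key _ oJ)//|/(key _ (orth_splitC oJ)) [|]].
  by right.
by move=> [d dE dJ]; left; exists d => // j Jj; apply: dJ; rewrite /= negbK.
Qed.

Lemma root_supported J mu : orth_split J -> is_root mu ->
  supported J mu \/ supported (predC J) mu.
Proof.
move=> oJ [mu0 [x x0 wx]]; have [_ _ rP] := alphaP G.
have [|c [muE|muE]] := rP mu; first by split=> //; exists x.
  by rewrite muE in wx *; apply: pos_root_supported wx x0.
(* A negative root is treated through a root vector of its opposite. *)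
have [f wf xf] := opposite_root_vector mu0 x0 wx.
have f0 : f <> 0.
  move=> f0; rewrite f0 liex0 in xf; apply: mu0; apply/lfunP => y.
  by rewrite -dual_vecE -xf bform0x lfunE.
rewrite muE opprK in wf; rewrite muE.
by case: (pos_root_supported oJ wf f0) => /supportedN; [left|right].
Qed.

(** [W] is spanned by the basis root vectors with root supported on [J] and the [tg i] with [J i].
    It is a nonzero ideal, hence everything; but [tg j] with [j] off [J] centralizes it, which is
    absurd. *)
Theorem dynkin_connected (J : pred (Idx G)) i0 :
  orth_split J -> J i0 -> forall j, J j.
Proof.
move=> oJ Ji0 j; apply/negPn/negP => nJj.
have [b [w [b_basis bw]]] := weight_basis (csaP G).
pose good (k : 'I_n) := `[< w k <> 0 /\ supported J (w k) >].
pose tg (i : Idx G) : g := vsval (tv (al i)).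
pose S := [seq b`_k | k : 'I_n <- enum good] ++
          map tg (enum J).
pose W := <<S>>%VS.
have tW i : J i -> vsval (tv (al i)) \in W.
  move=> Ji; apply: memv_span; rewrite mem_cat; apply/orP; right.
  by apply: (map_f tg); rewrite mem_enum.
have rW mu x : mu <> 0 -> supported J mu -> weight_vector mu x -> x \in W.
  move=> mu0 sJ wx; rewrite (coord_basis b_basis (memvf x)); apply: memv_suml => k _.
  have [->|xk] := eqVneq (coord b k x) 0; first by rewrite scale0r mem0v.
  have wk : w k = mu by apply: (weight_coord b_basis bw wx); apply/eqP.
  apply: memvZ; apply: memv_span; rewrite mem_cat; apply/orP; left.
  apply: (map_f (fun k : 'I_n => b`_k)); rewrite mem_enum.
  by apply/asboolP; rewrite wk.
have memS (y : g) : y \in S -> (exists2 k : 'I_n, good k & y = b`_k) \/ (exists2 i,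
  J i & y = tg i).
  rewrite mem_cat => /orP[/mapP[k]|/mapP[k]]; rewrite mem_enum => Pk ->.
    by left; exists k.
  by right; exists k.
have wW mu (u y : g) : weight_vector mu u -> y \in S -> lie u y \in W.
  move=> wu; have mu_cases : u <> 0 -> mu <> 0 -> supported J mu \/ supported
    (predC J) mu.
    by move=> u0 mu0; apply: root_supported => //; split=> //; exists u.
  have [->|/eqP u0] := eqVneq u 0; first by rewrite lie0x mem0v.
  move/memS => [[k /asboolP[wk0 sk] ->]|[i Ji ->]].
    have wub := weight_vector_lie wu (bw k).
    have [mu0|mu0] := pselect (mu = 0).
      by apply: (rW (mu + w k)); rewrite ?mu0 ?add0r // -[w k]add0r -mu0.
    case: (mu_cases u0 mu0) => [sJ|snJ].
      (* For opposite roots the bracket lies in [h]: it is a multiple of the vector dual to [w k], a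
         combination of the [tg i] with [J i]. *)
      have [muk|muk] := pselect (mu + w k = 0).
        have [d dE dJ] := sk; have uh : lie u b`_k \in h.
          by apply: weight0_csa; rewrite -muk.
        rewrite -(vsprojK uh).
        have -> : vsproj h (lie u b`_k) = - B u b`_k *: tv (w k).
          rewrite -linearZ /=; apply/esym/dual_vec_uniq => z.
          rewrite vsprojK // bform_lie lieC bw linearN linearZ /= scale_lfunE.
          by rewrite scaleNr; congr (- _); apply: mulrC.
        rewrite dE linear_sum linearZ /= linear_sum /=; apply: memvZ.
        apply: memv_suml => i _; rewrite -scaler_int linearZ linearZ /=.
        have [Ji|nJi] := boolP (J i); first by apply: memvZ; apply: tW.
        by rewrite dJ // scale0r mem0v.
      by apply: (rW (mu + w k)) => //; apply: supportedD.
    (* Here [mu] and [w k] are on different sides. A nonzero bracket would make [mu + w k] a root on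
       one side, so that [mu] or [w k] would lie on both sides and vanish. *)
    have [->|/eqP ub0] := eqVneq (lie u b`_k) 0; first exact: mem0v.
    have muk : mu + w k <> 0.
      move/eqP; rewrite addr_eq0 => /eqP muE; apply: mu0.
      by apply: (supported_disjoint (J := J)) => //; rewrite muE; apply: supportedN.
    have [|sJ|sJ] := root_supported oJ (mu := mu + w k).
    - by split=> //; exists (lie u b`_k).
    - case: mu0; apply: (supported_disjoint (J := J)) => //.
      by rewrite -[mu](addrK (w k)); apply: supportedD => //; apply: supportedN.
    case: wk0; apply: (supported_disjoint (J := J)) => //.
    by rewrite -[w k](addKr mu); apply: supportedD => //; apply: supportedN.
  rewrite lieC (weight_vector_dual _ wu) memvN.
  have [->|/eqP pi] := eqVneq (pair mu (al i)) 0; first by rewrite scale0r mem0v.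
  apply: memvZ; have mu0 : mu <> 0 by move=> mu0; case: pi; rewrite mu0 pairC linear0.
  case: (mu_cases u0 mu0) => [sJ|sJ]; first exact: rW sJ wu.
  by case: pi; apply: supported_orth (orth_splitC oJ) sJ _; rewrite /= negbK.
have idealW : lie_ideal W.
  move=> u y yW; rewrite (coord_span (X := in_tuple S) yW) linear_sum.
  apply: memv_suml => i _; rewrite linearZ /=; apply: memvZ.
  rewrite (coord_basis b_basis (memvf u)) lie_sumx.
  apply: memv_suml => k _; rewrite lieZx; apply: memvZ; apply: wW (bw k) _.
  by rewrite mem_nth.
have t_neq0 i : vsval (tv (al i)) <> 0.
  move=> t0; have [al0 _] := alpha_root i; apply: al0; apply/lfunP => y.
  by rewrite -dual_vecE t0 bform0x lfunE.
have [_ /(_ W idealW)[W0|Wfull]] := sgl_simple G.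
  by apply: (t_neq0 i0); apply/eqP; rewrite -memv0 -W0 tW.
apply: (t_neq0 j); apply: center0 => z.
have : z \in W by rewrite Wfull memvf.
move=> zW; rewrite (coord_span (X := in_tuple S) zW) linear_sum big1 // => k _.
rewrite linearZ /= (_ : lie _ _ = 0) ?scaler0 //.
have : S`_k \in S by rewrite mem_nth.
case/memS => [[l /asboolP[_ sl] ->]|[i Ji ->]].
  rewrite (weight_vector_dual _ (bw l)).
  by rewrite (supported_orth oJ sl nJj) scale0r.
by have [habel _ _] := csaP G; apply: habel; apply: subvsP.
Qed.
End Dynkin.

(** * Lattices and weights of the module *)

Section Lattices.
Variables (C : numFieldType) (G : simple_setup C).
Local Notation wt := (weight G).
Local Notation al := (@alpha _ G).

Lemma ipair_eq (mu nu : wt) (z : int) : pair mu nu = z%:~R -> ipair mu nu = z.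
Proof.
move=> E; rewrite /ipair; case: xgetP => [y _ /=|/(_ z)]; last by case.
by rewrite E => /intr_inj.
Qed.

Lemma coroot_pairE mu i z : coroot_pair mu i = z%:~R ->
  pair mu (al i) = ((dsym i)%:Z * z)%:~R.
Proof.
have ai := pair_alpha_gt0 i; rewrite /coroot_pair => /(canRL (mulfVK (lt0r_neq0 ai))).
rewrite pair_alpha aform_diag => E; apply: (@mulfI _ 2); first by rewrite pnatr_eq0.
by rewrite E !intrM PoszM intrM; ring.
Qed.

(** Integrality of [pair mu (al i)] keeps [ipair] away from its default value. *)
Lemma ipairE (mu : wt) i :
  weight_lattice mu -> (ipair mu (al i))%:~R = pair mu (al i).
Proof. by move=> /(_ i)[z /coroot_pairE E]; rewrite (ipair_eq E). Qed.

Lemma pair0x (nu : wt) : pair 0 nu = 0.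
Proof. by rewrite pairC linear0. Qed.

Lemma pairNx (mu nu : wt) : pair (- mu) nu = - pair mu nu.
Proof. by rewrite !pairE opp_lfunE. Qed.

Lemma weight_lattice0 : weight_lattice (0 : wt).
Proof. by move=> i; exists 0; rewrite /coroot_pair pair0x mulr0 mul0r. Qed.

Lemma weight_latticeD (mu nu : wt) :
  weight_lattice mu -> weight_lattice nu -> weight_lattice (mu + nu).
Proof.
move=> wm wn i; have [[z zE] [t tE]] := (wm i, wn i); exists (z + t).
by rewrite intrD -zE -tE /coroot_pair pairDx mulrDr mulrDl.
Qed.

Lemma weight_latticeN (mu : wt) : weight_lattice mu -> weight_lattice (- mu).
Proof.
move=> wm i; have [z zE] := wm i; exists (- z).
by rewrite rmorphN /= -zE /coroot_pair pairNx mulrN mulNr.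
Qed.

Lemma weight_lattice_alpha i : weight_lattice (al i).
Proof.
move=> j; exists (acart j i); rewrite /coroot_pair pairC !pair_alpha aform_diag.
have dj : (dsym j)%:R != 0 :> C by rewrite pnatr_eq0 -lt0n dsym_gt0.
have two0 : (2 : C) != 0 by rewrite pnatr_eq0.
rewrite /aform intrM PoszM intrM -!pmulrn; field.
by rewrite ?two0 ?dj.
Qed.

Section Zspan.
Variable S : set wt.

Lemma zspan0 : zspan S 0.
Proof. by exists 0%N, (fun=> 0), (fun=> 0); split=> [[]|]; rewrite ?big_ord0. Qed.

Lemma zspanN mu : zspan S mu -> zspan S (- mu).
Proof.
move=> [m [c [s [Ss ->]]]]; exists m, (fun l => - c l), s; split=> //.
by rewrite -sumrN; apply: eq_bigr => l _; rewrite mulrNz.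
Qed.

Lemma zspanD mu nu : zspan S mu -> zspan S nu -> zspan S (mu + nu).
Proof.
move=> [m [c [s [Ss ->]]]] [m' [c' [s' [Ss' ->]]]].
pose cat (T : Type) (f : 'I_m -> T) (f' : 'I_m' -> T) (l : 'I_(m + m')) :=
  match fintype.split l with inl j => f j | inr j => f' j end.
exists (m + m')%N, (cat _ c c'), (cat _ s s'); split.
  by move=> l; rewrite /cat; case: fintype.split.
by rewrite big_split_ord; congr (_ + _); apply: eq_bigr => l _;
   rewrite /cat ?(unsplitK (inl l)) ?(unsplitK (inr l)).
Qed.

Lemma zspan_ind (p : wt -> Prop) : p 0 ->
  (forall mu nu, p mu -> p nu -> p (mu + nu)) -> (forall mu, p mu -> p (- mu)) ->
  (forall mu, S mu -> p mu) -> forall mu, zspan S mu -> p mu.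
Proof.
move=> p0 pD pN pS _ [m [c [s [Ss ->]]]].
elim/big_ind: _ => // l _; have ps := pS _ (Ss l).
have pn k : p (s l *+ k) by elim: k => [|k IHk]; rewrite ?mulr0n // mulrS; apply: pD.
by case: (c l) => k; [apply: pn|rewrite NegzE mulrNz; apply: pN; apply: pn].
Qed.
End Zspan.

Lemma root_lattice_sum (c : Idx G -> int) : root_lattice (\sum_i al i *~ c i).
Proof.
elim/big_ind: _ => [||i _]; [exact: zspan0|exact: zspanD|].
exists 1%N, (fun=> c i), (fun=> al i); split; last by rewrite big_ord1.
by move=> _; exists i.
Qed.

Lemma root_sum_weight_lattice (c : Idx G -> int) :
  weight_lattice (\sum_i al i *~ c i).
Proof.
elim/zspan_ind: _ / (root_lattice_sum c) => [|mu nu|mu|_ [i _ <-]].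
- exact: weight_lattice0.
- exact: weight_latticeD.
- exact: weight_latticeN.
exact: weight_lattice_alpha.
Qed.

Lemma root_latticeP (mu : wt) :
  root_lattice mu -> exists c : Idx G -> int, mu = \sum_i al i *~ c i.
Proof.
elim/zspan_ind: mu / => [|mu nu [c ->] [d ->]|mu [c ->]|_ [i _ <-]].
- by exists (fun=> 0); rewrite big1.
- exists (fun i => c i + d i); rewrite -big_split; apply: eq_bigr => i _.
  by rewrite mulrzDr.
- exists (fun i => - c i); rewrite -sumrN; apply: eq_bigr => i _.
  by rewrite mulrNz.
exists (fun j => (j == i)%:Z); exact: alpha_delta.
Qed.

Lemma root_lattice_alpha i : root_lattice (al i).
Proof. by apply: zspan_sub; exists i. Qed.

Lemma ipair_sum_alpha (mu : wt) (c : Idx G -> int) : weight_lattice mu ->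
  ipair mu (\sum_i al i *~ c i) = \sum_i ipair mu (al i) * c i.
Proof.
move=> wmu; apply: ipair_eq; rewrite pair_sum_alpha rmorph_sum.
by apply: eq_bigr => i _; rewrite rmorphM /= ipairE.
Qed.

Lemma ipairDl (mu nu be : wt) : weight_lattice mu -> weight_lattice nu ->
  root_lattice be -> ipair (mu + nu) be = ipair mu be + ipair nu be.
Proof.
move=> wmu wnu /root_latticeP[c ->]; rewrite !ipair_sum_alpha //; last first.
  exact: weight_latticeD.
rewrite -big_split; apply: eq_bigr => i _ /=; rewrite -mulrDl; congr (_ * _).
by apply: ipair_eq; rewrite pairDx -!ipairE // intrD.
Qed.

Lemma ipairNl (mu be : wt) : weight_lattice mu ->
  root_lattice be -> ipair (- mu) be = - ipair mu be.
Proof.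
move=> wmu rbe; apply/eqP; rewrite -addr_eq0 -ipairDl //; last exact: weight_latticeN.
by rewrite addNr; apply/eqP/ipair_eq; rewrite pairC linear0.
Qed.

Lemma ipairC (mu nu : wt) : ipair mu nu = ipair nu mu.
Proof. by rewrite /ipair pairC. Qed.

End Lattices.

Lemma q_neq0 : q != 0.
Proof. by rewrite tofrac_eq0 polyX_eq0. Qed.

Lemma exprq_eq1 n : q ^+ n = 1 -> n = 0%N.
Proof.
rewrite -tofracXn -(tofrac1 {poly rat}) => /eqP; rewrite tofrac_eq => /eqP.
by move/(congr1 (fun p : {poly rat} => size p)); rewrite size_polyXn size_poly1 => -[].
Qed.

(** The indeterminate [q] is not a root of unity; this is how weights are recovered from eigenvalues
    of the [K]. *)
Lemma exprzq_inj : injective (fun a : int => q ^ a).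
Proof.
move=> a b /= ab; have qab : q ^ (a - b) = 1.
  by rewrite expfzDr ?q_neq0 // ab -expfzDr ?q_neq0 // subrr.
apply/eqP; rewrite -subr_eq0; move: qab; case: (a - b) => n.
  by move/exprq_eq1 => ->.
by rewrite NegzE -exprz_inv -exprnP exprVn => /(congr1 GRing.inv);
  rewrite invrK invr1 => /exprq_eq1.
Qed.

(** * The relations of [Uq] as commutation rules *)

Section UqRelations.
Variables (C : numFieldType) (G : simple_setup C) (E : set (weight G)).
Local Notation wt := (weight G).
Local Notation al := (@alpha _ G).

Let urel := @palg_rel _ (Uq_pres E).

Lemma uK_gen (mu : wt) (Em : E mu) : uK E mu = @gen _ (Uq_pres E) (GK Em).
Proof.
rewrite /uK; case: pselect => // Em'.
by rewrite (Prop_irrelevance Em' Em).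
Qed.

Lemma uKD (mu ga : wt) : E mu -> E ga -> E (mu + ga) ->
  uK E (mu + ga) = uK E mu * uK E ga.
Proof.
by move=> Em Eg Emg; rewrite !uK_gen; have /= -> := urel (Uq_KK Em Eg Emg).
Qed.

Lemma uK0 : E 0 -> uK E 0 = 1.
Proof. by move=> E0; rewrite uK_gen; have /= -> := urel (Uq_K0 E0); rewrite scale1r. Qed.

Lemma uKN (mu : wt) : E 0 -> E mu -> E (- mu) -> uK E mu * uK E (- mu) = 1.
Proof. by move=> E0 Em EN; rewrite -uKD ?subrr ?uK0. Qed.

Lemma uNK (mu : wt) : E 0 -> E mu -> E (- mu) -> uK E (- mu) * uK E mu = 1.
Proof. by move=> E0 Em EN; rewrite -uKD ?addNr ?uK0. Qed.

Lemma uKE_comm (mu : wt) j : E 0 -> E mu -> E (- mu) ->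
  uK E mu * uE E j = q ^ ipair mu (al j) *: (uE E j * uK E mu).
Proof.
move=> E0 Em EN; have := urel (Uq_KE Em EN j); rewrite /= -!uK_gen ?mulr_algl.
move/(congr1 (fun x => x * uK E mu)); rewrite /= -[X in X = _]mulrA uNK // mulr1.
by rewrite -scalerAl.
Qed.

Lemma uKF_comm (mu : wt) j : E 0 -> E mu -> E (- mu) ->
  uK E mu * uF E j = q ^ (- ipair mu (al j)) *: (uF E j * uK E mu).
Proof.
move=> E0 Em EN; have := urel (Uq_KF Em EN j); rewrite /= -!uK_gen ?mulr_algl.
move/(congr1 (fun x => x * uK E mu)); rewrite /= -[X in X = _]mulrA uNK // mulr1.
by rewrite -scalerAl.
Qed.

Lemma uEF i j : E (al i) -> E (- al i) ->
  uE E i * uF E j - uF E j * uE E i =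
  ((i == j)%:R / (qi i - (qi i)^-1)) *: (uK E (al i) - uK E (- al i)).
Proof.
move=> Ea EN; have := urel (Uq_EF j Ea EN); rewrite /= -!uK_gen.
by rewrite !scaleN1r !mulN1r mulr_algl.
Qed.

(** With [serre id] the term is written in the index set itself, so the same term can be interpreted
    in [Uq], in [Udot] and in operators. *)
Lemma uE_serre i j : i <> j -> interp (uE E) (serre id i j) = 0.
Proof.
move=> ij; have := urel (Uq_serreE E ij).
rewrite /= scale0r interp_serre => <-; exact: interp_serre.
Qed.

Lemma uF_serre i j : i <> j -> interp (uF E) (serre id i j) = 0.
Proof.
move=> ij; have := urel (Uq_serreF E ij).
rewrite /= scale0r interp_serre => <-; exact: interp_serre.
Qed.
End UqRelations.

(** A subspace of maximal dimension among those inside [p] absorbs every vector satisfying [p]. This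
    makes irreducibility, stated for [vspace]s, applicable to predicates. *)
Lemma vspace_of_pred (k : fieldType) (V : vectType k) (p : V -> Prop) :
  p 0 -> (forall c u v, p u -> p v -> p (c *: u + v)) ->
  exists W : {vspace V}, forall w, w \in W <-> p w.
Proof.
move=> p0 pl; pose ok d := `[< exists2 W : {vspace V}, \dim W = d & forall w, w \in
  W -> p w >].
have ok0 : exists d, ok d.
  exists 0%N; apply/asboolP; exists 0%VS; first exact: dimv0.
  by move=> w; rewrite memv0 => /eqP ->.
have okle d : ok d -> (d <= \dim {:V})%N.
  by move=> /asboolP[W <- _]; apply: dimvS; apply: subvf.
case: (ex_maxnP ok0 okle) => d /asboolP[W Wd Wp] dmax.
exists W => w; split; first exact: Wp.
move=> pw; have sW : (W <= W + <[w]>)%VS := addvSl _ _.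
have : W == (W + <[w]>)%VS.
  rewrite eqEdim sW /= Wd; apply: dmax; apply/asboolP.
  exists (W + <[w]>)%VS => // _ /memv_addP[u uW [v /vlineP[c ->] ->]].
  by rewrite addrC; apply: pl => //; apply: Wp.
by move/eqP => ->; rewrite -[X in X \in _]add0r memv_add ?mem0v ?memv_line.
Qed.

(** * Weights of the irreducible module *)

Section ModuleWeights.
Variables (C : numFieldType) (G : simple_setup C).
Local Notation wt := (weight G).
Local Notation al := (@alpha _ G).
Local Notation Q := (@root_lattice _ G).
Variables (V : vectType Qq) (act : Uq Q -> V -> V) (la : wt).
Hypothesis hw : is_irreducible_hw act la.
Hypothesis la_dom : dominant_integral la.
Hypothesis la_neq0 : la <> 0.

Let Hmod : is_module act. Proof. by case: hw. Qed.
Let actMw x y w : act (x * y) w = act x (act y w).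
Proof. by case: Hmod => _ _ _ ->. Qed.
Let act1 w : act 1 w = w.
Proof. by case: Hmod => _ _ -> _. Qed.
Let act_linear x : linear (act x).
Proof. by move=> c u v; case: Hmod => _ -> _ _. Qed.
Let actDx x y w : act (x + y) w = act x w + act y w.
Proof. by case: Hmod => /(_ 1 x y w) + _ _ _; rewrite !scale1r. Qed.
Let act0x w : act 0 w = 0.
Proof. by apply: (addIr (act 0 w)); rewrite -actDx !add0r. Qed.
Let actZx c x w : act (c *: x) w = c *: act x w.
Proof. by case: Hmod => /(_ c x 0 w) + _ _ _; rewrite act0x !addr0. Qed.
Let actDw x w w' : act x (w + w') = act x w + act x w'.
Proof. by have := act_linear x 1 w w'; rewrite !scale1r. Qed.
Let act0w x : act x 0 = 0.
Proof. by apply: (addIr (act x 0)); rewrite -actDw !add0r. Qed.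
Let actZw x c w : act x (c *: w) = c *: act x w.
Proof. by rewrite -[c *: w]addr0 act_linear act0w addr0. Qed.

Let Q0 : Q 0 := zspan0 _.
Let QN mu : Q mu -> Q (- mu) := @zspanN _ _ _ mu.

Lemma weight_space_uE mu u i : weight_lattice mu -> weight_space act mu u ->
  weight_space act (mu + al i) (act (uE Q i) u).
Proof.
move=> wmu mu_u be Qbe; rewrite -actMw (uKE_comm _ Q0 Qbe (QN Qbe)) actZx actMw
  mu_u // actZw.
rewrite scalerA ipairDl //; last exact: weight_lattice_alpha.
by rewrite -expfzDr ?q_neq0 // addrC (ipairC (al i)).
Qed.

Lemma weight_space_uF mu u i : weight_lattice mu -> weight_space act mu u ->
  weight_space act (mu - al i) (act (uF Q i) u).
Proof.
move=> wmu mu_u be Qbe; rewrite -actMw (uKF_comm _ Q0 Qbe (QN Qbe)) actZx actMw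
  mu_u // actZw.
rewrite scalerA ipairDl //; last exact/weight_latticeN/weight_lattice_alpha.
by rewrite -expfzDr ?q_neq0 // addrC (ipairC be) ipairNl //; apply: weight_lattice_alpha.
Qed.

Lemma weight_space_lin mu c u v : weight_space act mu u -> weight_space act mu v ->
  weight_space act mu (c *: u + v).
Proof.
by move=> mu_u mu_v be Qbe; rewrite act_linear mu_u // mu_v // scalerDr !scalerA mulrC.
Qed.

Lemma weight_space0 mu : weight_space act mu 0.
Proof. by move=> be _; rewrite act0w scaler0. Qed.

Lemma weights_la : weights act la.
Proof.
have [_ _ _ [w [w0 wla _]]] := hw; split; last by exists w.
by move=> i; have [m ->] := la_dom i; exists m%:Z.
Qed.

(** If neither [E_i] nor [F_i] moves a weight vector [u], their commutator kills it, so [K_i] and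
    its inverse have the same eigenvalue on [u] and [pair mu (al i) = 0]. *)
Lemma weights_step mu i : weights act mu -> pair mu (al i) <> 0 ->
  exists nu, weights act nu /\ weights act (nu + al i).
Proof.
move=> [wmu [u u0 mu_u]] pmu; have wal := weight_lattice_alpha i.
have [Eu|Eu] := pselect (act (uE Q i) u = 0); last first.
  exists mu; split; first by split=> //; exists u.
  split; first exact: weight_latticeD.
  by exists (act (uE Q i) u) => //; apply: weight_space_uE.
have [Fu|Fu] := pselect (act (uF Q i) u = 0); last first.
  exists (mu - al i); rewrite subrK; split; last by split=> //; exists u.
  split; first exact/weight_latticeD/weight_latticeN.
  by exists (act (uF Q i) u) => //; apply: weight_space_uF.
have Qa := root_lattice_alpha i; have Qa' := QN Qa.
case: pmu; have := congr1 (act ^~ u) (uEF i Qa Qa'); rewrite eqxx mul1r.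
rewrite -scaleN1r -[uK Q _ - _]addrC -scaleN1r !actDx !actZx !actDx !actZx !actMw
  Eu Fu !act0w.
rewrite scaler0 addr0 !mu_u // scalerA -scalerDl scalerA => /esym/eqP.
rewrite scaler_eq0 => /orP[|/eqP//]; rewrite mulf_eq0 invr_eq0 subr_eq0.
have d0 := dsym_gt0 i.
case/orP => [/eqP E|].
  have : q ^+ (dsym i + dsym i) = 1.
    rewrite exprD -/(qi i) {1}E mulVf // /qi expf_neq0 //; exact: q_neq0.
  by move/exprq_eq1/eqP; rewrite addn_eq0 eqn0Ngt d0.
rewrite mulN1r addrC subr_eq0 => /eqP/exprzq_inj E.
rewrite -ipairE //; suff -> : ipair mu (al i) = 0 by [].
have neg : ipair mu (- al i) = - ipair mu (al i).
  by apply: ipair_eq; rewrite linearN /= -ipairE // rmorphN.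
move: E; rewrite neg; lia.
Qed.

Lemma weights_alpha i : exists nu, weights act nu /\ weights act (nu + al i).
Proof.
pose J j := `[< forall mu, weights act mu -> pair mu (al j) = 0 >].
have step j : ~~ J j -> exists nu, weights act nu /\ weights act (nu + al j).
  move=> /asboolP /existsNP[mu /not_implyP[wmu pmu]]; exact: weights_step wmu pmu.
apply: (step); apply/negP => Ji; apply: la_neq0; apply: pair_alpha_eq0 => j.
have Jall : forall j, J j.
  apply: dynkin_connected Ji => k l /asboolP Jk /step[nu [wnu wnul]].
  have := Jk _ wnul; rewrite pairDx (Jk _ wnu) add0r => <-; exact: pairC.
by have /asboolP := Jall j; apply; apply: weights_la.
Qed.

(** The list may repeat weights, so sums are added by concatenating lists and pushed forward by
    mapping them. *)
Fixpoint weight_sum (ms : seq wt) (w : V) : Prop :=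
  match ms with
  | [::] => w = 0
  | nu :: ms' => exists u w', [/\ weight_space act nu u, weight_sum ms' w' & w = u + w']
  end.

Lemma weight_sum_lin ms c u v : weight_sum ms u -> weight_sum ms v ->
  weight_sum ms (c *: u + v).
Proof.
elim: ms u v => [|nu ms IH] u v /=; first by move=> -> ->; rewrite scaler0 addr0.
move=> [u1 [u2 [wu1 su2 ->]]] [v1 [v2 [wv1 sv2 ->]]].
exists (c *: u1 + v1), (c *: u2 + v2); split; [exact: weight_space_lin|exact: IH|].
by rewrite scalerDr addrACA.
Qed.

Lemma weight_sum0 ms : weight_sum ms 0.
Proof.
elim: ms => //= nu ms IH; exists 0, 0; split=> //; rewrite ?addr0 //.
exact: weight_space0.
Qed.

Lemma weight_sum_cat ms ms' u v : weight_sum ms u -> weight_sum ms' v ->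
  weight_sum (ms ++ ms') (u + v).
Proof.
elim: ms u => [|nu ms IH] u /=; first by move=> ->; rewrite add0r.
move=> [u1 [u2 [wu1 su2 ->]]] sv; exists u1, (u2 + v); split=> //; first exact: IH.
by rewrite addrA.
Qed.

Lemma weight_sum_map (f : wt -> wt) x ms w :
  (forall mu u, mu \in ms -> weight_space act mu u -> weight_space act (f mu) (act
    x u)) ->
  weight_sum ms w -> weight_sum (map f ms) (act x w).
Proof.
move=> fx; elim: ms w fx => [|nu ms IH] w fx /=; first by move=> ->; rewrite act0w.
move=> [u1 [u2 [wu1 su2 ->]]]; exists (act x u1), (act x u2).
split; [by apply: fx => //; rewrite mem_head| |exact: actDw].
by apply: IH => // mu u mums; apply: fx; rewrite inE mums orbT.
Qed.

Lemma weight_space_uK mu be u : Q be -> weight_space act mu u ->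
  weight_space act mu (act (uK Q be) u).
Proof.
move=> Qbe mu_u; rewrite mu_u // -[_ *: _]addr0.
by apply: weight_space_lin => //; apply: weight_space0.
Qed.

(** Choose [i] with [al i] separating [mu] from the head [nu]. The operator
    [K_i - q ^ ipair nu (al i)] kills the component of weight [nu], keeps the others in their weight
    spaces and scales [u] by [c <> 0]. *)
Lemma weight_sum_indep ms mu u : weight_lattice mu -> weight_space act mu u ->
  (forall nu, nu \in ms -> weight_lattice nu /\ nu <> mu) ->
  weight_sum ms u -> u = 0.
Proof.
move=> wmu; elim: ms u => [|nu ms IH] u mu_u ms_mu //= [u1 [u2 [wu1 su2 uE]]].
have [wnu nu_mu] := ms_mu nu (mem_head _ _).
have [i ni] : exists i, ipair mu (al i) <> ipair nu (al i).
  apply: contrapT => /forallNP E; apply: nu_mu; apply/esym/eqP; rewrite -subr_eq0;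
    apply/eqP.
  apply: pair_alpha_eq0 => i; rewrite pairDx pairNx -!ipairE //.
  by rewrite (contrapT (E i)) subrr.
have Qa := root_lattice_alpha i.
pose c := q ^ ipair mu (al i) - q ^ ipair nu (al i).
have c0 : c != 0 by rewrite subr_eq0; apply/eqP => /exprzq_inj.
have cu : c *: u = - q ^ ipair nu (al i) *: u2 + act (uK Q (al i)) u2.
  rewrite scalerBl -mu_u // uE actDw wu1 // !scalerDr scaleNr opprD addrACA subrr
    add0r addrC.
  by [].
have : c *: u = 0.
  apply: IH.
  - by rewrite -[_ *: _]addr0; apply: weight_space_lin => //; apply: weight_space0.
  - by move=> nu' nu'ms; apply: ms_mu; rewrite inE nu'ms orbT.
  rewrite cu; apply: weight_sum_lin => //; rewrite -[ms]map_id.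
  by apply: weight_sum_map su2 => mu' u' _; apply: weight_space_uK.
by move/eqP; rewrite scaler_eq0 (negPf c0) => /eqP.
Qed.

Let coset (nu : wt) := weight_lattice nu /\ Q (nu - la).

(** Sums of vectors with weights in the coset of [la] form a submodule that contains the highest
    weight vector, hence all of [V]. A vector of weight outside the coset is then zero by
    [weight_sum_indep]. *)
Lemma weights_coset mu : weights act mu -> Q (mu - la).
Proof.
pose p w := exists2 ms, (forall nu, nu \in ms -> coset nu) & weight_sum ms w.
have p0 : p 0 by exists [::].
have pD u v : p u -> p v -> p (u + v).
  move=> [ms msc su] [ms' ms'c sv]; exists (ms ++ ms'); last exact: weight_sum_cat.
  by move=> nu; rewrite mem_cat => /orP[/msc|/ms'c].
have pZ c u : p u -> p (c *: u).
  move=> [ms msc su]; exists ms => //; rewrite -[_ *: _]addr0.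
  by apply: weight_sum_lin => //; apply: weight_sum0.
have [W WP] : exists W : {vspace V}, forall w, w \in W <-> p w.
  by apply: vspace_of_pred => // c u v pu pv; apply: pD => //; apply: pZ.
have pmap x (f : wt -> wt) : (forall nu, coset nu -> coset (f nu)) ->
    (forall nu u, coset nu -> weight_space act nu u ->
       weight_space act (f nu) (act x u)) ->
    forall w, p w -> p (act x w).
  move=> fc fx w [ms msc sw]; exists (map f ms).
    by move=> _ /mapP[nu /msc nuc ->]; apply: fc.
  by apply: weight_sum_map => // nu u /msc nuc; apply: fx.
have pact x : forall w, p w -> p (act x w).
  elim/palg_ind: x => [[i|i|be Qbe]|c|x y IHx IHy|x y IHx IHy] w.
  - apply: (pmap (uE Q i) (fun nu => nu + al i)) => [nu [wnu Qnu]|nu u [wnu Qnu]].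
      split; first by apply: weight_latticeD => //; apply: weight_lattice_alpha.
      by rewrite addrAC; apply: zspanD => //; apply: root_lattice_alpha.
    exact: weight_space_uE.
  - apply: (pmap (uF Q i) (fun nu => nu - al i)) => [nu [wnu Qnu]|nu u [wnu Qnu]].
      split; first by apply/weight_latticeD/weight_latticeN => //;
        apply: weight_lattice_alpha.
      by rewrite addrAC; apply: zspanD => //; apply/zspanN/root_lattice_alpha.
    exact: weight_space_uF.
  - rewrite -uK_gen; apply: (pmap (uK Q be) id) => // nu u _.
    exact: weight_space_uK.
  - by rewrite actZx act1; apply: pZ.
  - by move=> pw; rewrite actDx; apply: pD; [apply: IHx|apply: IHy].
  - by move=> pw; rewrite actMw; apply/IHx/IHy.
have [_ [_ irr] _ [w0 [w0n w0la _]]] := hw.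
have pw0 : p w0.
  exists [:: la]; last by exists w0, 0; split=> //; rewrite addr0.
  move=> nu; rewrite inE => /eqP ->; split; first by case: weights_la.
  by rewrite subrr; apply: Q0.
have [x w /WP pw|W0|Wf] := irr W; first exact/WP/pact.
  by case: w0n; apply/eqP; rewrite -memv0 -W0; apply/WP.
move=> [wmu [u u0 mu_u]]; apply: contrapT => nQ; apply: u0.
have /WP[ms msc su] : u \in W by rewrite Wf memvf.
apply: weight_sum_indep wmu mu_u _ su => nu /msc[wnu Qnu]; split=> // E.
by apply: nQ; rewrite -E.
Qed.

End ModuleWeights.

(** * The action on quasi-periodic functions *)

Lemma comm_inverse (A : nzRingType) (x y y' : A) :
  y * y' = 1 -> y' * y = 1 -> GRing.comm x y -> GRing.comm x y'.
Proof.
move=> yy' y'y xy; rewrite /GRing.comm -[LHS]mul1r -y'y.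
by rewrite -mulrA [y * _]mulrA -xy -mulrA yy' mulr1.
Qed.

Section UdotRelations.
Variables (C : numFieldType) (G : simple_setup C) (la : weight G).
Local Notation wt := (weight G).
Local Notation al := (@alpha _ G).
Local Notation U := (Udot la).
Local Notation xi := (uxi la).
Local Notation x := (ux la).
Local Notation xil := (uxil la).

Let urel := @palg_rel _ (Udot_pres la).

Lemma uxiV b i : xi b i * xi (~~ b) i = 1.
Proof. by have := urel (Udot_xi_inv la b i); rewrite /= scale1r. Qed.

Lemma uxilV b : xil b * xil (~~ b) = 1.
Proof. by have := urel (Udot_xil_inv la b); rewrite /= scale1r. Qed.

Lemma uxi_comm b i b' j : GRing.comm (xi b i) (xi b' j).
Proof.
have same c k l : GRing.comm (xi c k) (xi c l).
  have := urel (Udot_xi_xi la c k l); rewrite /= scale0r scaleN1r mulN1r => /eqP.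
  by rewrite subr_eq0 => /eqP.
have [<-//|bb'] := eqVneq b b'.
have -> : b' = ~~ b by case: (b) (b') bb' => [] [].
by apply: (comm_inverse (y := xi b j)); rewrite ?uxiV //; have := uxiV (~~ b) j;
  rewrite negbK.
Qed.

Lemma uxi_uxil_comm b i b' : GRing.comm (xi b i) (xil b').
Proof.
have same c : GRing.comm (xi c i) (xil c).
  have := urel (Udot_xi_xil la c i); rewrite /= scale0r scaleN1r mulN1r => /eqP.
  by rewrite subr_eq0 => /eqP.
have [<-//|bb'] := eqVneq b b'.
have -> : b' = ~~ b by case: (b) (b') bb' => [] [].
by apply: (comm_inverse (y := xil b)); rewrite ?uxilV //; have := uxilV (~~ b);
  rewrite negbK.
Qed.

Lemma uxi_ux i b j :
  xi true i * x b j = q ^ (sgn b * ipair (al i) (al j)) *: (x b j * xi true i).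
Proof.
have := urel (Udot_xi_x la b i j); rewrite /= mulr_algl.
move/(congr1 (fun u => u * xi true i)); rewrite /= -[X in X = _]mulrA.
by rewrite (uxiV false i) mulr1 -scalerAl.
Qed.

Lemma uxil_ux b j :
  xil true * x b j = q ^ (sgn b * ipair la (al j)) *: (x b j * xil true).
Proof.
have := urel (Udot_xil_x la b j); rewrite /= mulr_algl.
move/(congr1 (fun u => u * xil true)); rewrite /= -[X in X = _]mulrA.
by rewrite (uxilV false) mulr1 -scalerAl.
Qed.

Lemma uxilN_ux b j :
  xil false * x b j = q ^ (- (sgn b * ipair la (al j))) *: (x b j * xil false).
Proof.
have := congr1 (fun u => xil false * u * xil false) (uxil_ux b j) => /=.
rewrite mulrA (uxilV false) mul1r -scalerAr -scalerAl -!mulrA (uxilV true) mulr1.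
move=> ->; rewrite scalerA -expfzDr ?q_neq0 // addNr expr0z scale1r.
by [].
Qed.

Lemma ux_comm i j : x true i * x false j - x false j * x true i =
  ((i == j)%:R / (qi i - (qi i)^-1)) *: (xi true i - xi false i).
Proof.
have := urel (Udot_x_x la i j).
by rewrite /= !scaleN1r !mulN1r mulr_algl.
Qed.

Lemma ux_serre b i j : i <> j -> interp (x b) (serre id i j) = 0.
Proof.
move=> ij; have := urel (Udot_serre la b ij); rewrite /= scale0r interp_serre => <-.
exact: interp_serre.
Qed.

Definition uxi_pow i (c : int) : U :=
  match c with Posz m => xi true i ^+ m | Negz m => xi false i ^+ m.+1 end.

Lemma uxi_powS i c : uxi_pow i (c + 1) = xi true i * uxi_pow i c.
Proof.
case: c => [m|[|m]].
- have -> : Posz m + 1 = Posz m.+1 by lia.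
  by rewrite /= exprS.
- have -> : Negz 0 + 1 = Posz 0 by lia.
  by rewrite /= expr0 expr1 (uxiV true).
have -> : Negz m.+1 + 1 = Negz m by lia.
by rewrite /= [in RHS]exprS mulrA (uxiV true) mul1r.
Qed.

Lemma uxi_comm_pow b i j c : GRing.comm (xi b i) (uxi_pow j c).
Proof. by case: c => m /=; apply: commrX; apply: uxi_comm. Qed.

(** The [xi] commute, so the extra factor moves to the front; this is the quasi-periodicity of
    [qper_one_fun]. *)
Lemma uxi_pow_delta (s : seq (Idx G)) (c : Idx G -> int) i : uniq s ->
  \prod_(j <- s) uxi_pow j (c j + (j == i)%:Z) =
  (if i \in s then xi true i else 1) * \prod_(j <- s) uxi_pow j (c j).
Proof.
elim: s => [|a s IHs] /=; first by rewrite !big_nil mulr1.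
move=> /andP[nas us]; rewrite !big_cons IHs // inE.
have [<-|ai] := eqVneq a i.
  by rewrite ?eqxx /= (negPf nas) mul1r uxi_powS !mulrA.
rewrite ?(eq_sym i) ?(negPf ai) /= addr0 !mulrA; congr (_ * _).
by case: ifP => _; [rewrite uxi_comm_pow|rewrite mulr1 mul1r].
Qed.
End UdotRelations.

Section QuasiPeriodic.
Variables (C : numFieldType) (G : simple_setup C) (la : weight G).
Hypothesis la_wt : weight_lattice la.
Local Notation wt := (weight G).
Local Notation al := (@alpha _ G).
Local Notation U := (Udot la).
Local Notation xi := (uxi la).
Local Notation x := (ux la).
Local Notation xil := (uxil la).
Local Notation D := (Idx G -> int).

Definition coords (mu : wt) : D := fun j => ipair mu (al j).

Lemma coordsD mu nu : weight_lattice mu -> weight_lattice nu ->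
  coords (mu + nu) = coords mu + coords nu.
Proof.
by move=> wm wn; apply/funext => j; apply: ipairDl => //; apply: root_lattice_alpha.
Qed.

Lemma coordsN mu : weight_lattice mu -> coords (- mu) = - coords mu.
Proof.
by move=> wm; apply/funext => j; apply: ipairNl => //; apply: root_lattice_alpha.
Qed.

Lemma coords0 : coords 0 = 0.
Proof. by apply/funext => j; apply: ipair_eq; rewrite pair0x. Qed.

(* The functions [t |-> K_t v]: the translation by a root lattice element acts
   by the corresponding element of [Udot], while the other translations are free. *)
Definition is_quasi_periodic : {pred D -> U} :=
  fun g => `[< forall t i, g (t + coords (al i)) = xi true i * g t >].

Fact quasi_periodic_submod : submod_closed is_quasi_periodic.
Proof.
split=> [|c g g' /asboolP gP /asboolP gP']; apply/asboolP => t i.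
  by rewrite -[LHS]/(0 : U) -[X in _ * X]/(0 : U) mulr0.
rewrite -[LHS]/(c *: g _ + g' _) -[X in _ * X]/(c *: g t + g' t) gP gP'.
by rewrite mulrDr -scalerAr.
Qed.
HB.instance Definition _ := GRing.isSubmodClosed.Build Qq (D -> U)
  is_quasi_periodic quasi_periodic_submod.

Record qper : Type := Qper { qper_val :> D -> U; qperP : qper_val \in is_quasi_periodic }.
HB.instance Definition _ := [isSub for qper_val].
HB.instance Definition _ := [Choice of qper by <:].
HB.instance Definition _ := [SubChoice_isSubLmodule of qper by <:].

Lemma qper_eq (g g' : qper) : (forall t, g t = g' t) -> g = g'.
Proof. by move=> gg; apply: val_inj; apply/funext. Qed.

Lemma qperE (g : qper) t i : g (t + coords (al i)) = xi true i * g t.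
Proof. by have /asboolP := qperP g. Qed.

Lemma qperNE (g : qper) t i : g (t + coords (- al i)) = xi false i * g t.
Proof.
rewrite -{2}[t](subrK (coords (al i))) qperE mulrA (uxiV la false) mul1r.
by rewrite coordsN //; apply: weight_lattice_alpha.
Qed.

(** By [pair_alpha_eq0] the coordinates determine the weight, and the weight determines its
    coefficients. Hence the choice made in [qper_one_fun] is harmless. *)
Lemma coords_alpha_free (c c' : Idx G -> int) :
  coords (\sum_i al i *~ c i) = coords (\sum_i al i *~ c' i) -> c = c'.
Proof.
have wl := @root_sum_weight_lattice C G.
move=> cc; apply/funext; apply: alpha_free; apply/eqP; rewrite -subr_eq0; apply/eqP.
apply: pair_alpha_eq0 => i; rewrite pairDx pairNx -!ipairE //.
by rewrite -/(coords _ i) cc subrr.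
Qed.

(** Quasi-periodicity and the value 1 at 0 dictate the values on the image of the root lattice. The
    complement of that image is stable under its translations, so 0 is allowed there. *)
Definition qper_one_fun (t : D) : U :=
  if pselect (exists c, t = coords (\sum_i al i *~ c i)) is left tc
  then \prod_(i <- enum (Idx G)) uxi_pow la i (projT1 (cid tc) i) else 0.

Lemma qper_one_funE (c : Idx G -> int) :
  qper_one_fun (coords (\sum_i al i *~ c i)) =
  \prod_(i <- enum (Idx G)) uxi_pow la i (c i).
Proof.
rewrite /qper_one_fun; case: pselect => [tc|[]]; last by exists c.
by case: cid => d /= /coords_alpha_free ->.
Qed.

Lemma qper_one_subproof : qper_one_fun \in is_quasi_periodic.
Proof.
have wl := @root_sum_weight_lattice C G.
have shift c i : coords (\sum_j al j *~ c j) + coords (al i) =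
    coords (\sum_j al j *~ (c j + (j == i)%:Z)).
  rewrite -coordsD //; last exact: weight_lattice_alpha.
  rewrite [in LHS](alpha_delta i) -big_split; congr coords.
  by apply: eq_bigr => j _; rewrite mulrzDr.
apply/asboolP => t i; have [[c ->]|nt] := pselect (exists c, t = coords (\sum_i al
  i *~ c i)).
  by rewrite shift !qper_one_funE uxi_pow_delta ?enum_uniq // mem_enum.
rewrite /qper_one_fun; case: pselect => [[c tc]|_]; last first.
  by case: pselect => // _; rewrite mulr0.
case: nt; exists (fun j => c j - (j == i)%:Z).
apply: (addIr (coords (al i))); rewrite tc shift; congr coords.
by apply: eq_bigr => j _; rewrite subrK.
Qed.
Definition qper_one : qper := Qper qper_one_subproof.

Lemma qper_one0 : qper_one 0 = 1.
Proof.
have := qper_one_funE (fun=> 0);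
  rewrite [X in coords X]big1 // coords0 -[qper_one 0]/(qper_one_fun 0) => ->.
by rewrite big1.
Qed.

Lemma qper_one_neq0 : qper_one <> 0.
Proof.
move/(congr1 (fun g : qper => g 0)); rewrite qper_one0 -[RHS]/(0 : U) => /eqP.
by rewrite oner_eq0.
Qed.

Local Notation E := (endo qper_one_neq0).

Section MakeEndo.
Variables (f : (D -> U) -> D -> U).
Hypothesis f_qper : forall g, g \in is_quasi_periodic -> f g \in is_quasi_periodic.
Hypothesis f_linear : forall c g g' t, f (c *: g + g') t = c *: f g t + f g' t.

Definition qper_map (g : qper) : qper := Qper (f_qper (qperP g)).

Fact qper_map_endo : qper_map \in @is_endo _ qper.
Proof. by apply/asboolP => c g g'; apply: qper_eq => t; apply: f_linear. Qed.

Definition qper_endo : E := Endo _ qper_map_endo.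

End MakeEndo.

Lemma funD (g g' : D -> U) t : (g + g') t = g t + g' t.
Proof. by []. Qed.
Lemma funZ c (g : D -> U) t : (c *: g) t = c *: g t.
Proof. by []. Qed.

Definition shift (mu : wt) (g : D -> U) : D -> U := fun t => g (t + coords mu).

Fact shift_qper mu g : g \in is_quasi_periodic -> shift mu g \in is_quasi_periodic.
Proof. by move=> /asboolP gP; apply/asboolP => t i; rewrite /shift addrAC gP. Qed.
Fact shift_linear mu c g g' t : shift mu (c *: g + g') t = c *: shift mu g t +
  shift mu g' t.
Proof. by []. Qed.

Definition opK mu : E := qper_endo (@shift_qper mu) (@shift_linear mu).

Definition raise b j (g : D -> U) : D -> U := fun t => q ^ (sgn b * t j) *: (x b j * g t).

(** Translation by [coords (al i)] multiplies the factor [q ^ (sgn b * t j)] by exactly the power of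
    [q] that arises when [xi true i] passes [x b j]. *)
Fact raise_qper b j g : g \in is_quasi_periodic -> raise b j g \in is_quasi_periodic.
Proof.
move=> /asboolP gP; apply/asboolP => t i; rewrite /raise gP -scalerAr [in RHS]mulrA.
rewrite uxi_ux -scalerAl scalerA -expfzDr ?q_neq0 // -mulrA -mulrDr.
by [].
Qed.
Fact raise_linear b j c g g' t :
  raise b j (c *: g + g') t = c *: raise b j g t + raise b j g' t.
Proof.
by rewrite /raise funD funZ mulrDr scalerDr -scalerAr !scalerA mulrC.
Qed.

Definition opX b j : E := qper_endo (@raise_qper b j) (@raise_linear b j).

(** The action of [v] for [true] and of its inverse for [false]: the translation by [la] cancels
    that of [K_la] in [K_la v^-1], leaving multiplication by [xil true]. *)
Definition twist b (g : D -> U) : D -> U :=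
  fun t => xil (~~ b) * g (if b then t + coords la else t - coords la).

Fact twist_qper b g : g \in is_quasi_periodic -> twist b g \in is_quasi_periodic.
Proof.
move=> /asboolP gP; apply/asboolP => t i;
  rewrite /twist [in RHS]mulrA uxi_uxil_comm -mulrA.
by case: b => /=; rewrite -gP addrAC.
Qed.
Fact twist_linear b c g g' t :
  twist b (c *: g + g') t = c *: twist b g t + twist b g' t.
Proof. by rewrite /twist funD funZ mulrDr -scalerAr. Qed.

Definition opv b : E := qper_endo (@twist_qper b) (@twist_linear b).

Lemma opKE mu (g : qper) t : opK mu g t = g (t + coords mu).
Proof. by []. Qed.
Lemma opXE b j (g : qper) t : opX b j g t = q ^ (sgn b * t j) *: (x b j * g t).
Proof. by []. Qed.
Lemma opvE b (g : qper) t :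
  opv b g t = xil (~~ b) * g (if b then t + coords la else t - coords la).
Proof. by []. Qed.
Lemma opDE (f f' : E) g t : (f + f') g t = f g t + f' g t.
Proof. by []. Qed.
Lemma opZE c (f : E) g t : (c *: f) g t = c *: f g t.
Proof. by []. Qed.
Lemma opNE (f : E) g t : (- f) g t = - f g t.
Proof. by rewrite -scaleN1r opZE scaleN1r. Qed.
Lemma opME (f f' : E) g : (f * f') g = f (f' g).
Proof. by []. Qed.
Lemma op_eq (f f' : E) : (forall g t, f g t = f' g t) -> f = f'.
Proof. by move=> ff; apply: endo_eq => g; apply: qper_eq. Qed.

Lemma opX_exp b j m (g : qper) t :
  (opX b j ^+ m) g t = q ^ (sgn b * t j * m%:Z) *: (x b j ^+ m * g t).
Proof.
elim: m g => [|m IHm] g; first by rewrite mulr0 expr0z expr0 mul1r scale1r.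
rewrite exprS opME opXE IHm -scalerAr scalerA -expfzDr ?q_neq0 // mulrA -exprS.
by congr (q ^ _ *: _); lia.
Qed.

(** All monomials of the Serre relation have degree [m] in [i] and 1 in [j], so their powers of [q]
    coincide and factor out of the relation in [Udot]. *)
Lemma opX_serre b i j : i <> j -> interp (opX b) (serre id i j) = 0.
Proof.
move=> ij; apply: op_eq => g t; rewrite interp_serre -[RHS]/(0 : U).
set m := `|_|%N.
rewrite (big_morph (fun f : E => f g t) (id1 := 0) (op1 := +%R)) //.
have := ux_serre la b ij; rewrite interp_serre -/m.
move/(congr1 (fun u => q ^ (sgn b * (t i * m%:Z + t j)) *: (u * g t))).
rewrite mul0r scaler0 => E0; apply: etrans E0; rewrite mulr_suml scaler_sumr;
  apply: eq_bigr => k _.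
rewrite opZE !opME opX_exp opXE opX_exp -[in RHS]scalerAl [RHS]scalerA.
rewrite [X in _ = X *: _]mulrC -[RHS]scalerA; congr (_ *: _);
  rewrite -!scalerAr !scalerA -!mulrA -!expfzDr ?q_neq0 //.
congr (q ^ _ *: _).
have km : (k <= m)%N by rewrite -ltnS.
have -> : ((m - k)%N : int) = m%:Z - k%:Z by rewrite subzn.
by ring.
Qed.

Section Action.
Variable L : set wt.
Hypothesis L_wt : forall mu, L mu -> weight_lattice mu.

Lemma Uq_action : exists rho : {lrmorphism Uq L -> E},
  [/\ forall i, rho (uE L i) = opX true i, forall i, rho (uF L i) = opX false i
    & forall mu, L mu -> rho (uK L mu) = opK mu].
Proof.
have [|rho [rhoE _]] := @palg_lift _ (Uq_pres L) E
  (fun z => match z with GE i => opX true i | GF i => opX false i | GK mu _ => opK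
    mu end).
  move=> s t; case=> {s t} /=.
  - move=> mu ga Em Eg Emg; apply: op_eq => g t; rewrite opME !opKE coordsD; auto.
    by rewrite addrA.
  - move=> E0; rewrite scale1r; apply: op_eq => g t; rewrite opKE coords0 addr0 //.
  - move=> mu Em Em' j; apply: op_eq => g t.
    rewrite mulr_algl !opME opZE opKE !opXE opKE coordsN; last exact: L_wt.
    by rewrite addrK scalerA -expfzDr ?q_neq0 // !mul1r addrC.
  - move=> mu Em Em' j; apply: op_eq => g t.
    rewrite mulr_algl !opME opZE opKE !opXE opKE coordsN; last exact: L_wt.
    by rewrite addrK scalerA -expfzDr ?q_neq0 // !mulN1r -opprD addrC.
  - move=> i j Ea Ea'; apply: op_eq => g t.
    rewrite mulr_algl !scaleN1r !mulN1r opZE !opDE !opNE !opME !opXE !opKE.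
    (* On quasi-periodic functions the translations by [al i] and [- al i] are [xi true i] and
       [xi false i], as the relation in [Udot] requires. *)
    rewrite qperE qperNE -!scalerAr !scalerA -!expfzDr ?q_neq0 // -mulrBl [RHS]scalerAl.
    rewrite -ux_comm [sgn false * _ + _]addrC -scalerBr !mulrA -mulrBl.
    (* The remaining factor [q ^ (t i - t j)] is 1 for [i = j]; otherwise the commutator is zero. *)
    have [->|ij] := eqVneq i j.
      by rewrite mul1r mulN1r subrr expr0z scale1r.
    by rewrite ux_comm (negPf ij) mul0r !scale0r !mul0r scaler0.
  - move=> i j ij; rewrite scale0r -(opX_serre true ij) !interp_serre.
    by apply: eq_bigr.
  - move=> i j ij; rewrite scale0r -(opX_serre false ij) !interp_serre.
    by apply: eq_bigr.
by exists rho; split=> [i|i|mu Lmu]; rewrite ?uK_gen; apply: rhoE.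
Qed.

Lemma opvV b : opv b * opv (~~ b) = 1.
Proof.
apply: op_eq => g t; rewrite opME !opvE mulrA uxilV mul1r.
by case: b => /=; rewrite ?addrK ?subrK.
Qed.

Lemma laurent_action : exists sigma : {lrmorphism laurent Qq -> E},
  sigma (vp Qq) = opv true /\ sigma (vm Qq) = opv false.
Proof.
have [|sigma [sigmaE _]] := @palg_lift _ (laurent_pres Qq) E opv.
  by move=> s t; case=> {s t} b /=; rewrite opvV scale1r.
by exists sigma; split; apply: sigmaE.
Qed.

Lemma opvK b mu : GRing.comm (opv b) (opK mu).
Proof.
apply: op_eq => g t; rewrite !opME opKE !opvE opKE.
by case: b; rewrite addrAC.
Qed.

(** The power of [q] from moving [xil (~~ b)] past [x c j] is cancelled by the one from translating
    [t j] by [la]. *)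
Lemma opvX b c j : GRing.comm (opv b) (opX c j).
Proof.
apply: op_eq => g t; rewrite !opME opXE !opvE opXE -!scalerAr !mulrA.
case: b => /=; rewrite ?uxilN_ux ?uxil_ux -scalerAl scalerA -expfzDr ?q_neq0 //.
  by congr (q ^ _ *: _); rewrite -[(t + _) j]/(t j + _) /coords; ring.
by congr (q ^ _ *: _); rewrite -[(t - _) j]/(t j - _) /coords; ring.
Qed.

(* Through the action on quasi-periodic functions, the image of [y] maps [g] to
   a function whose value at [0] is [y * g 0]; take [g 0 = 1]. *)
Lemma Udot_embedding (f : {lrmorphism U -> tensor_laurent (Uq L)}) :
  L la -> (forall i, L (al i)) -> (forall mu, L mu -> L (- mu)) ->
  (forall i, f (x true i) = uE L i ⊗ 1) ->
  (forall i, f (x false i) = uF L i ⊗ 1) ->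
  (forall i, f (xi true i) = uK L (al i) ⊗ 1) ->
  (forall i, f (xi false i) = uK L (- al i) ⊗ 1) ->
  f (xil true) = uK L la ⊗ vm Qq -> f (xil false) = uK L (- la) ⊗ vp Qq ->
  injective f.
Proof.
move=> Lla Lal LN fE fF fK fK' fla fla'.
have [rho [rE rF rK]] := Uq_action; have [sigma [sp sm]] := laurent_action.
have [|Phi PhiE] := tensor_lift (rho := rho) (sigma := sigma).
  move=> a b; suff : GRing.comm (rho a) (sigma b) by [].
  apply: (comm_palg (P := laurent_pres Qq) (h := sigma)) => b'.
  apply: commr_sym; apply: (comm_palg (P := Uq_pres L) (h := rho)) => a'.
  have -> : sigma (gen b') = opv b' by case: b'.
  case: a' => [i|i|mu Lmu].
  - by rewrite [rho _]rE; apply: opvX.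
  - by rewrite [rho _]rF; apply: opvX.
  by rewrite -uK_gen rK //; apply: opvK.
(* All [g] are needed: for a product [y * z] the hypothesis on [y] is applied to [Phi (f z) g]. *)
have main y : forall g, Phi (f y) g 0 = y * g 0.
  elim/palg_ind: y => [[b i|b i|b]|c|y z IHy IHz|y z IHy IHz] g.
  - case: b; rewrite -[gen _]/(xi _ i) ?fK ?fK' PhiE rmorph1 mulr1 rK; auto.
      by rewrite opKE qperE.
    by rewrite opKE qperNE.
  - case: b; rewrite -[gen _]/(x _ i) ?fE ?fF PhiE rmorph1 mulr1 ?rE ?rF;
    by rewrite opXE mulr0 expr0z scale1r.
  - case: b; rewrite -[gen _]/(xil _) ?fla ?fla' PhiE ?sp ?sm rK; auto.
      by rewrite opME opKE opvE addrK.
    by rewrite opME opKE opvE coordsN // addrNK.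
  - rewrite linearZ /= rmorph1 linearZ /= rmorph1.
    by rewrite -[LHS]/(c *: g 0) mulr_algl.
  - by rewrite rmorphD /= rmorphD -[LHS]/(Phi (f y) g 0 + Phi (f z) g 0) IHy IHz mulrDl.
  by rewrite rmorphM /= rmorphM -[LHS]/(Phi (f y) (Phi (f z) g) 0) IHy IHz mulrA.
apply: raddf_inj => y fy0; have := main y qper_one.
by rewrite qper_one0 mulr1 fy0 raddf0 => <-.
Qed.
End Action.
End QuasiPeriodic.

(** * The isomorphism *)

Section Isomorphism.
Variables (C : numFieldType) (G : simple_setup C).
Local Notation wt := (weight G).
Local Notation al := (@alpha _ G).
Local Notation Q := (@root_lattice _ G).
Variables (la : wt) (V : vectType Qq) (act : Uq Q -> V -> V).
Hypothesis la_neq0 : la <> 0.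
Hypothesis la_dom : dominant_integral la.
Hypothesis hw : is_irreducible_hw act la.
Local Notation L := (weights_span act).
Local Notation inA := (subalg_pred (@bU_gens _ _ _ act)).

Let L0 : L 0 := zspan0 _.
Let LD mu nu : L mu -> L nu -> L (mu + nu) := @zspanD _ _ _ mu nu.
Let LN mu : L mu -> L (- mu) := @zspanN _ _ _ mu.
Let Lw mu : weights act mu -> L mu. Proof. exact: zspan_sub. Qed.
Let la_w : weights act la := weights_la hw la_dom.
Let Lla : L la := Lw la_w.
Let la_wt : weight_lattice la. Proof. by case: la_w. Qed.

Lemma weights_span_lattice mu : L mu -> weight_lattice mu.
Proof.
elim/zspan_ind=> [|mu1 mu2|mu1|mu1 [//]].
- exact: weight_lattice0.
- exact: weight_latticeD.
exact: weight_latticeN.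
Qed.

Let Lal i : L (al i).
Proof.
have [nu [wnu wnual]] := weights_alpha hw la_dom la_neq0 i.
by rewrite -[al i](addKr nu); apply: LD; [apply/LN/Lw|apply: Lw].
Qed.

Lemma bU_uE i : uE L i ⊗ 1 \in inA.
Proof. by apply/asboolP/in_subalg_gen; left; left; left; exists i. Qed.

Lemma bU_uF i : uF L i ⊗ 1 \in inA.
Proof. by apply/asboolP/in_subalg_gen; left; left; right; exists i. Qed.

Lemma bU_uKm mu : weights act mu -> uK L mu ⊗ vm Qq \in inA.
Proof. by move=> wmu; apply/asboolP/in_subalg_gen; left; right; exists mu. Qed.

Lemma bU_uKp mu : weights act mu -> uK L (- mu) ⊗ vp Qq \in inA.
Proof. by move=> wmu; apply/asboolP/in_subalg_gen; right; exists mu. Qed.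

(** The powers of [v] cancel between the generators of [mu] and [nu]; this is how elements [K]
    without [v] enter [bU]. *)
Lemma bU_uK_sub mu nu : weights act mu -> weights act nu -> uK L (mu - nu) ⊗ 1 \in inA.
Proof.
move=> wmu wnu.
have -> : uK L (mu - nu) ⊗ 1 = (uK L mu ⊗ vm Qq) * (uK L (- nu) ⊗ vp Qq).
  by rewrite tensM vmp uKD //; [apply: Lw|apply/LN/Lw|apply: LD; [|apply: LN]; apply: Lw].
by apply: rpredM; [apply: bU_uKm|apply: bU_uKp].
Qed.

Lemma bU_uK_alpha b i : uK L (if b then al i else - al i) ⊗ 1 \in inA.
Proof.
have [nu [wnu wnual]] := weights_alpha hw la_dom la_neq0 i.
case: b; first by rewrite -[al i](addKr nu) addrC; apply: bU_uK_sub.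
have -> : - al i = nu - (nu + al i) by rewrite opprD addrA subrr add0r.
exact: bU_uK_sub.
Qed.

Lemma bU_uKla b : (if b then uK L la ⊗ vm Qq else uK L (- la) ⊗ vp Qq) \in inA.
Proof. by case: b; [apply: bU_uKm|apply: bU_uKp]. Qed.

Lemma bU_uX b i : (if b then uE L i else uF L i) ⊗ 1 \in inA.
Proof. by case: b; [apply: bU_uE|apply: bU_uF]. Qed.

Definition assignment (z : Udot_gen G) : bU act :=
  match z with
  | Gxi b i => Subalg (bU_uK_alpha b i)
  | Gx b i => Subalg (bU_uX b i)
  | Gxil b => Subalg (bU_uKla b)
  end.

Lemma uK_comm mu nu : L mu -> L nu -> GRing.comm (uK L mu) (uK L nu).
Proof.
by move=> Lmu Lnu; rewrite /GRing.comm -!uKD ?[nu + mu]addrC //; apply: LD.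
Qed.

Lemma uKX_conj mu b j : L mu ->
  uK L mu * (if b then uE L j else uF L j) * uK L (- mu) =
  q ^ (sgn b * ipair mu (al j)) *: (if b then uE L j else uF L j).
Proof.
move=> Lmu; have LNmu := LN Lmu; case: b; rewrite ?mul1r ?mulN1r.
  by rewrite uKE_comm // -scalerAl -mulrA uKN // mulr1.
by rewrite uKF_comm // -scalerAl -mulrA uKN // mulr1.
Qed.

Lemma assignment_rel s t : Udot_rel la s t -> interp assignment s = interp assignment t.
Proof.
move=> st; apply: val_inj; rewrite -![val _]/(subalg_incl _) !interp_morph /=.
case: st => {s t} /=; rewrite /subalg_incl /=.
- move=> b i; rewrite scale1r tensM mul1r.
  case: b => /=; rewrite ?uKN ?uNK ?tens1r ?rmorph1 //; exact: LN.
- move=> b; rewrite scale1r; case: b;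
  rewrite /= tensM ?vmp ?vpm ?uKN ?uNK ?tens1r ?rmorph1 //; exact: LN.
- move=> b i j; rewrite scale0r scaleN1r mulN1r !tensM !mul1r.
  rewrite uK_comm ?subrr //; case: b => //; exact: LN.
- move=> b i; rewrite scale0r scaleN1r mulN1r; apply/eqP; rewrite subr_eq0; apply/eqP.
  by case: b; rewrite !tensM mul1r mulr1 uK_comm //; exact: LN.
- move=> b i j; rewrite !tensM !mulr1 mulr_algl.
  by have := uKX_conj b j (Lal i); rewrite !tens1r => ->; rewrite linearZ.
- move=> b j; rewrite !tensM mulr1 vmp mulr_algl.
  by have := uKX_conj b j Lla; rewrite !tens1r => ->; rewrite linearZ.
- move=> i j; rewrite !scaleN1r !mulN1r !tens1r -!rmorphM -!rmorphB /= uEF //;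
  last exact: LN.
  by rewrite linearZ mulr_algl.
move=> b i j ij; rewrite scale0r interp_serre /=.
have E0 : tinl (interp (if b then uE L else uF L) (serre id i j)) = 0.
  by case: b; rewrite ?uE_serre ?uF_serre // linear0.
apply: etrans E0; rewrite (interp_morph (@tinl _ (Uq L))) interp_serre.
by apply: eq_bigr => k _; rewrite !tens1r; case: b.
Qed.

Theorem Udot_iso : exists phi : {lrmorphism Udot la -> bU act},
    [/\ bijective phi, extends_assignment phi
      & forall psi : {lrmorphism Udot la -> bU act},
          extends_assignment psi -> psi =1 phi].
Proof.
have [phi [phiE _]] := @palg_lift _ (Udot_pres la) (bU act) assignment assignment_rel.
have phi_ext : extends_assignment phi.
  by split=> [i|i|i|]; rewrite ?[phi _]phiE.
exists phi; split=> // [|psi psi_ext x]; last first.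
  elim/palg_ind: x => [z|c|y z IHy IHz|y z IHy IHz].
  - apply: val_inj; case: phi_ext psi_ext => [e1 e2 e3 [e4 e4']] [d1 d2 d3 [d4 d4']].
    case: z => [b i|b i|b]; case: b.
    + by have [a _] := e3 i; have [b _] := d3 i; rewrite [LHS]b [RHS]a.
    + by have [_ a] := e3 i; have [_ b] := d3 i; rewrite [LHS]b [RHS]a.
    + by rewrite [LHS]d1 [RHS]e1.
    + by rewrite [LHS]d2 [RHS]e2.
    + by rewrite [LHS]d4 [RHS]e4.
    by rewrite [LHS]d4' [RHS]e4'.
  - by rewrite !linearZ /= !rmorph1.
  - by rewrite !rmorphD /= IHy IHz.
  by rewrite !rmorphM /= IHy IHz.
have inj : injective phi.
  suff injv : injective (@subalg_incl _ _ _ \o phi) by move=> x y xy; apply: injv;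
    rewrite /= xy.
  have [e1 e2 e3 [e4 e4']] := phi_ext.
  apply: (Udot_embedding la_wt weights_span_lattice Lla Lal LN (f := @subalg_incl _
    _ _ \o phi)) => //.
  - by move=> i; have [] := e3 i.
  - by move=> i; have [] := e3 i.
pose im z := exists y, val (phi y) = z.
have imD z z' : im z -> im z' -> im (z + z').
  by move=> [y <-] [y' <-]; exists (y + y'); rewrite rmorphD.
have imM z z' : im z -> im z' -> im (z * z').
  by move=> [y <-] [y' <-]; exists (y * y'); rewrite rmorphM.
have [e1 e2 e3 [e4 e4']] := phi_ext.
(* Both signs are carried together so that the induction passes through negation. *)
have imK be : Q be -> L be /\ im (uK L be ⊗ 1) /\ im (uK L (- be) ⊗ 1).
  elim/zspan_ind => [|mu nu [Lmu [imu imu']] [Lnu [inu inu']]|mu [Lmu [imu imu']]|_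
    [i _ <-]].
  - by split=> //; rewrite oppr0 uK0 // tens1r rmorph1; split; exists 1; rewrite !rmorph1.
  - split; first exact: LD.
    have [LNm LNn] := (LN Lmu, LN Lnu).
    rewrite opprD !uKD //; try exact: LD.
    by rewrite -[1]mulr1 -!tensM; split; apply: imM.
  - by split; [apply: LN|rewrite opprK].
  split=> //; have [a b] := e3 i.
  by split; [exists (uxi la true i)|exists (uxi la false i)].
have imKw mu : weights act mu -> im (uK L mu ⊗ vm Qq) /\ im (uK L (- mu) ⊗ vp Qq).
  move=> wmu; have [LD1 [i1 i2]] := imK _ (weights_coset hw la_dom wmu).
  have LND1 := LN LD1.
  (* Split off [la]: the factor of [mu - la] lies in the root lattice and needs no [v]. *)
  rewrite -[mu](subrK la) opprD (uKD LD1 Lla (LD LD1 Lla)).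
  rewrite (uKD LND1 (LN Lla) (LD LND1 (LN Lla))).
  rewrite -[vm Qq]mul1r -[vp Qq]mul1r -!tensM; split; apply: imM => //.
    by exists (uxil la true).
  by exists (uxil la false).
have surj (z : bU act) : exists y, phi y = z.
  suff : im (val z) by move=> [y yz]; exists y; apply: val_inj.
  case: z => z /= /asboolP; elim=> {z} [z|c|z z' _ iz _ iz'|z z' _ iz _ iz'].
  - case=> [[[[i _ <-]|[i _ <-]]|[mu wmu <-]]|[mu wmu <-]].
    + by exists (ux la true i).
    + by exists (ux la false i).
    + by have [ij _] := imKw _ wmu.
    by have [_ ij] := imKw _ wmu.
  - by exists c%:A; rewrite !linearZ /= !rmorph1.
  - exact: imD.
  exact: imM.
have [g gP] := choice surj.
by exists g => x; rewrite ?gP //; apply: inj; rewrite gP.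
Qed.
End Isomorphism.

Theorem proposition3p3 (R : realType) (G : simple_setup R[i])
    (la : weight G) (V : vectType Qq)
    (act : Uq (@root_lattice _ G) -> V -> V) :
  la <> 0 -> dominant_integral la -> is_irreducible_hw act la ->
  exists phi : {lrmorphism Udot la -> bU act},
    [/\ bijective phi, extends_assignment phi
      & forall psi : {lrmorphism Udot la -> bU act},
          extends_assignment psi -> psi =1 phi].
Proof. exact: Udot_iso. Qed.
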